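(* There exist a sequence of positive integers $(d_n)_{n\in\mathbb N}$ and sequences of matrices $A_n,B_n\in\mathbb M_{d_n}(\mathbb C)$ such that (a) $\|A_n\|\leq 1$ and $\|B_n\|\leq 1$ for every $n\in\mathbb N$; (b) $\lim_{n\to\infty}\|A_nB_n-B_nA_n\|_2=\lim_{n\to\infty}\|A_nB_n^*-B_n^*A_n\|_2=0$; and (c) for any sequences of matrices $A_n',B_n'\in\mathbb M_{d_n}(\mathbb C)$ such that $A_n'B_n'=B_n'A_n'$ and $A_n'B_n'^*=B_n'^*A_n'$ for every $n\in\mathbb N$, one has $\inf_{n\in\mathbb N}\big(\|A_n-A_n'\|_2+\|B_n-B_n'\|_2\big)>0$.
   Context: For $A=(a_{i,j})_{i,j=1}^d\in\mathbb M_d(\mathbb C)$, $\|A\|$ denotes the operator norm and $\|A\|_2=\big(\frac1d\sum_{i,j=1}^d|a_{i,j}|^2\big)^{1/2}$ the normalized Hilbert–Schmidt norm; $A^*$ is the adjoint (conjugate transpose). *)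

(* Defs.v *)
From HB Require Import structures.
From mathcomp Require Import all_boot all_order all_algebra.
From mathcomp Require Import all_classical all_reals all_analysis.
From mathcomp Require Import complex.
Set Implicit Arguments. Unset Strict Implicit. Unset Printing Implicit Defensive.
Import Order.TTheory GRing.Theory Num.Theory.
Local Open Scope ring_scope.
Local Open Scope classical_set_scope.

Definition cmod (R : realType) (z : R[i]) : R := Normc.normc z.

Definition adj (R : realType) (d : nat) (A : 'M[R[i]]_d) : 'M[R[i]]_d :=
  (map_mx (fun z : R[i] => conjc z) A)^T.

Definition vnorm (R : realType) (d : nat) (v : 'cV[R[i]]_d) : R :=
  Num.sqrt (\sum_(i < d) cmod (v i ord0) ^+ 2).

Definition opnorm (R : realType) (d : nat) (A : 'M[R[i]]_d) : R :=
  sup [set vnorm (A *m v) | v in [set v : 'cV[R[i]]_d | vnorm v <= 1]].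

Definition hsnorm (R : realType) (d : nat) (A : 'M[R[i]]_d) : R :=
  Num.sqrt (d%:R^-1 * \sum_(i < d) \sum_(j < d) cmod (A i j) ^+ 2).

(* Main.v *)
Require Import Defs.
From HB Require Import structures.
From mathcomp Require Import all_boot all_order all_algebra.
From mathcomp Require Import all_classical all_reals all_analysis.
From mathcomp Require Import complex mxtens spectral.
From mathcomp Require Import ring lra zify.
Import Order.TTheory GRing.Theory Num.Theory numFieldNormedType.Exports.
Set Implicit Arguments. Unset Strict Implicit. Unset Printing Implicit Defensive.
Local Open Scope ring_scope.

(* Work in M_k (x) M_r (x) M_k, where k = 4N and M_r is the algebra of N spins.
   The matrix A lies in the first two factors and encodes, in its real and
   imaginary parts, the element sum_i e_ii (x) X_i together with generators of
   the first M_k that have a spectral gap independent of N; B is the mirror image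
   in the last two factors, with Z_i in place of X_i.  The Pauli matrices X_i and
   Z_j commute unless i = j, so the commutator of A and B has normalized
   Hilbert-Schmidt norm O(N^(-1/2)).

   If A' and B' commute exactly with each other and with adjoints, let S be the
   commutant of {A', A'^*} and S' its commutant.  Elements of S commute with A',
   hence almost commute with A, hence by the gap are uniformly close to
   1 (x) M_r (x) M_k.  Averaging the matrix units of the first M_k over S
   therefore moves them little and puts them in S'; they slice A' into elements
   p_i of S' that are close, on average over i, to multiples of X_i.  In the same
   way B' yields elements q_i of S'' close to multiples of Z_i.  But p_i and q_i
   commute while X_i and Z_i anticommute.

   The gap comes from the quantum Margulis expander: the clock, chirp and Fourier
   matrices act on the Weyl basis of M_N, indexed by (Z/N)^2, by phases, shears
   and rotations, and a ping-pong argument bounds the mass near the origin. *)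

(** Why the two estimates are compatible: the commutator of A and B consists of one piece per site
    i, living in e_ii (x) M_r (x) e_ii, a fraction 1/k^2 of the whole algebra, so N such pieces have
    total normalized square O(1/N). Slicing, in contrast, takes the single block i of A and copies
    it along the whole diagonal of M_k, so X_i is seen at full size. This costs a factor k in the
    error, but the error is summed over all k indices; since N = k/4 of them are sites, the average
    error per site is a constant times the squared distance from A to A'. The delicate point is to
    lose no power of N on the way: the gap must be uniform in N, and sums over the k^2 matrix units
    are estimated as row contractions rather than term by term. All generators of M_k have to fit
    into one matrix together with the spins, which is the reason for the factor 4 in k: three
    unitaries are placed between three levels, and the spins on a fourth. *)

(* Locked so that [ring] and [lra] treat norms as atoms. *)
HB.lock Definition ip (R : realType) (d : nat) (X Y : 'M[R[i]]_d) : R :=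
  complex.Re (\tr (X *m adj Y)).
HB.lock Definition nsq (R : realType) (d : nat) (X : 'M[R[i]]_d) : R := ip X X.
HB.lock Definition nrm (R : realType) (d : nat) (X : 'M[R[i]]_d) : R :=
  Num.sqrt (nsq X).

(** * Hilbert-Schmidt geometry of complex matrices, without normalization *)

Section Adjoint.
Variables (R : realType) (d : nat).
Local Notation C := R[i].
Implicit Types X Y Z : 'M[C]_d.

Lemma adjE X i j : adj X i j = conjc (X j i).
Proof. by rewrite !mxE. Qed.

Lemma adjK X : adj (adj X) = X.
Proof. by apply/matrixP => i j; rewrite !adjE conjcK. Qed.

Lemma adj_mul X Y : adj (X *m Y) = adj Y *m adj X.
Proof. by rewrite /adj map_mxM trmx_mul. Qed.

Lemma adjD X Y : adj (X + Y) = adj X + adj Y.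
Proof. by rewrite /adj map_mxD linearD. Qed.

Lemma adjN X : adj (- X) = - adj X.
Proof. by rewrite /adj map_mxN linearN. Qed.

Lemma adjB X Y : adj (X - Y) = adj X - adj Y.
Proof. by rewrite adjD adjN. Qed.

Lemma adj0 : adj (0 : 'M[C]_d) = 0.
Proof. by rewrite /adj map_mx0 trmx0. Qed.

Lemma adj1 : adj (1%:M : 'M[C]_d) = 1%:M.
Proof. by rewrite /adj map_mx1 trmx1. Qed.

Lemma adjZ (a : C) X : adj (a *: X) = conjc a *: adj X.
Proof. by rewrite /adj map_mxZ linearZ. Qed.

Lemma adj_sum (I : Type) (r : seq I) (P : pred I) (F : I -> 'M[C]_d) :
  adj (\sum_(i <- r | P i) F i) = \sum_(i <- r | P i) adj (F i).
Proof. by apply: (big_morph _ adjD adj0). Qed.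

Local Notation ip := (@ip R d).
Local Notation nsq := (@nsq R d).
Local Notation nrm := (@nrm R d).

Lemma nsq_ip X : nsq X = ip X X.
Proof. by rewrite nsq.unlock. Qed.

Lemma ReD (a b : C) : complex.Re (a + b) = complex.Re a + complex.Re b.
Proof. by case: a b => [? ?] [? ?]. Qed.

Lemma ReZ (a : R) (b : C) : complex.Re (a%:C%C * b) = a * complex.Re b.
Proof. by case: b => [? ?] /=; rewrite mul0r subr0. Qed.

Lemma ipE X Y : ip X Y = \sum_i \sum_j complex.Re (X i j * conjc (Y i j)).
Proof.
rewrite ip.unlock /mxtrace (big_morph (@complex.Re R) ReD (erefl _)).
apply: eq_bigr => i _; rewrite mxE (big_morph (@complex.Re R) ReD (erefl _)).
by apply: eq_bigr => j _; rewrite adjE.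
Qed.

Lemma cmod_sqr (z : C) : cmod z ^+ 2 = complex.Re z ^+ 2 + complex.Im z ^+ 2.
Proof. by case: z => a b; rewrite /cmod /= sqr_sqrtr// addr_ge0// sqr_ge0. Qed.

Lemma cmod_ge0 (z : C) : 0 <= cmod z.
Proof. by case: z => a b; exact: sqrtr_ge0. Qed.

Lemma nsqE X : nsq X = \sum_i \sum_j cmod (X i j) ^+ 2.
Proof.
rewrite !nsq_ip ipE; apply: eq_bigr => i _; apply: eq_bigr => j _.
by rewrite cmod_sqr; case: (X i j) => a b /=; rewrite mulrN opprK !expr2.
Qed.

Lemma nsq_ge0 X : 0 <= nsq X.
Proof. by rewrite nsqE; do 2!apply: sumr_ge0 => ? _; rewrite sqr_ge0. Qed.

Lemma nsq_eq0 X : nsq X = 0 -> X = 0.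
Proof.
move=> X0; apply/matrixP => i j; rewrite [RHS]mxE.
have s0 k : 0 <= \sum_j cmod (X k j) ^+ 2 by apply: sumr_ge0 => ? _; rewrite sqr_ge0.
move: X0; rewrite nsqE => /eqP; rewrite psumr_eq0// => /allP /(_ i).
rewrite mem_index_enum => /(_ isT)/=; rewrite psumr_eq0; last by move=> ? _; rewrite sqr_ge0.
move=> /allP/(_ j); rewrite mem_index_enum => /(_ isT)/=.
by rewrite sqrf_eq0 => /eqP /Normc.eq0_normc.
Qed.

Lemma ipC X Y : ip X Y = ip Y X.
Proof.
rewrite !ipE; apply: eq_bigr => i _; apply: eq_bigr => j _.
case: (X i j) (Y i j) => [a b] [c e] /=; ring.
Qed.

Lemma ipDl X Y Z : ip (X + Y) Z = ip X Z + ip Y Z.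
Proof. by rewrite ip.unlock mulmxDl mxtraceD ReD. Qed.

Lemma ip0l Z : ip 0 Z = 0.
Proof. by rewrite ip.unlock mul0mx mxtrace0. Qed.

Lemma ipNl X Z : ip (- X) Z = - ip X Z.
Proof. by apply/eqP; rewrite -addr_eq0 -ipDl addNr ip0l. Qed.

Lemma ipDr X Y Z : ip Z (X + Y) = ip Z X + ip Z Y.
Proof. by rewrite ipC ipDl !(ipC Z). Qed.

Lemma ipNr X Z : ip Z (- X) = - ip Z X.
Proof. by rewrite ipC ipNl ipC. Qed.

Lemma ip_suml (I : Type) (r : seq I) (P : pred I) (F : I -> 'M[C]_d) Z :
  ip (\sum_(i <- r | P i) F i) Z = \sum_(i <- r | P i) ip (F i) Z.
Proof. by apply: (big_morph (ip^~ Z)) => [X Y|]; [exact: ipDl|exact: ip0l]. Qed.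

Lemma ip_sumr (I : Type) (r : seq I) (P : pred I) (F : I -> 'M[C]_d) Z :
  ip Z (\sum_(i <- r | P i) F i) = \sum_(i <- r | P i) ip Z (F i).
Proof. by rewrite ipC ip_suml; apply: eq_bigr => i _; rewrite ipC. Qed.

Lemma ipZl (a : R) X Y : ip (a%:C%C *: X) Y = a * ip X Y.
Proof. by rewrite ip.unlock -scalemxAl mxtraceZ ReZ. Qed.

Lemma ip_adj X Y : ip (adj X) (adj Y) = ip X Y.
Proof. by rewrite ipC !ip.unlock adjK mxtrace_mulC. Qed.

Lemma ip_mull X Y Z : ip (X *m Y) Z = ip Y (adj X *m Z).
Proof. by rewrite ip.unlock adj_mul adjK mxtrace_mulC !mulmxA mxtrace_mulC mulmxA. Qed.

Lemma ip_mulr X Y Z : ip (X *m Y) Z = ip X (Z *m adj Y).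
Proof. by rewrite ip.unlock adj_mul adjK mulmxA. Qed.

Lemma nsq_adj X : nsq (adj X) = nsq X.
Proof. by rewrite !nsq_ip ip_adj. Qed.

Lemma nsq0 : nsq 0 = 0. Proof. by rewrite nsq_ip ip0l. Qed.

Lemma nsqN X : nsq (- X) = nsq X.
Proof. by rewrite !nsq_ip ipNl ipNr opprK. Qed.

Lemma nsqD X Y : nsq (X + Y) = nsq X + 2 * ip X Y + nsq Y.
Proof. by rewrite !nsq_ip !ipDl !ipDr (ipC Y X); ring. Qed.

Lemma nsqZ (z : C) X : nsq (z *: X) = cmod z ^+ 2 * nsq X.
Proof.
rewrite !nsqE mulr_sumr; apply: eq_bigr => i _; rewrite mulr_sumr.
by apply: eq_bigr => j _; rewrite mxE /cmod Normc.normcM exprMn.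
Qed.

Lemma ip_le_nsq X Y : 2 * ip X Y <= nsq X + nsq Y.
Proof. by have := nsq_ge0 (X - Y); rewrite nsqD ipNr nsqN; lra. Qed.

Lemma nsqD_le X Y : nsq (X + Y) <= 2 * (nsq X + nsq Y).
Proof. by have := ip_le_nsq X Y; rewrite nsqD; lra. Qed.

Lemma nsqD3_le X Y Z : nsq (X + Y + Z) <= 3 * (nsq X + nsq Y + nsq Z).
Proof.
have := ip_le_nsq X Y; have := ip_le_nsq X Z; have := ip_le_nsq Y Z.
by rewrite !nsqD ipDl; lra.
Qed.

Lemma nrmE X : nrm X = Num.sqrt (nsq X).
Proof. by rewrite nrm.unlock. Qed.

Lemma nrm_ge0 X : 0 <= nrm X. Proof. by rewrite nrmE sqrtr_ge0. Qed.

Lemma nrm_sqr X : nrm X ^+ 2 = nsq X.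
Proof. by rewrite nrmE sqr_sqrtr ?nsq_ge0. Qed.

(** Scaling each matrix by the norm of the other gives both the same norm, and then the
    arithmetic-geometric bound [ip_le_nsq] is already Cauchy-Schwarz. *)
Lemma ip_le_nrm X Y : ip X Y <= nrm X * nrm Y.
Proof.
have [X0|X0] := eqVneq (nrm X) 0.
  by rewrite X0 mul0r (nsq_eq0 (_ : nsq X = 0)) ?ip0l// -nrm_sqr X0 expr0n.
have [Y0|Y0] := eqVneq (nrm Y) 0.
  by rewrite Y0 mulr0 ipC (nsq_eq0 (_ : nsq Y = 0)) ?ip0l// -nrm_sqr Y0 expr0n.
have Xp : 0 < nrm X by rewrite lt_def X0 nrm_ge0.
have Yp : 0 < nrm Y by rewrite lt_def Y0 nrm_ge0.
have := ip_le_nsq ((nrm Y)%:C%C *: X) ((nrm X)%:C%C *: Y).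
have nC (a : R) : cmod (a%:C%C) ^+ 2 = a ^+ 2 by rewrite cmod_sqr /= expr0n addr0.
rewrite ipZl ipC ipZl ipC !nsqZ !nC -!nrm_sqr => h.
have p : 0 < nrm X * nrm Y by rewrite mulr_gt0.
rewrite -(ler_pM2l p); move: h; set x := nrm X; set y := nrm Y; nra.
Qed.

Lemma nrmD_le X Y : nrm (X + Y) <= nrm X + nrm Y.
Proof.
rewrite -(ler_pXn2r (n := 2)) ?nnegrE ?addr_ge0 ?nrm_ge0//.
rewrite nrm_sqr nsqD; have := ip_le_nrm X Y; rewrite -!nrm_sqr; nra.
Qed.

Lemma nrmN X : nrm (- X) = nrm X. Proof. by rewrite !nrmE nsqN. Qed.
Lemma nrm0 : nrm 0 = 0. Proof. by rewrite !nrmE nsq0 sqrtr0. Qed.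
Lemma nrm_adj X : nrm (adj X) = nrm X. Proof. by rewrite !nrmE nsq_adj. Qed.

Lemma nrmB_le X Y : nrm (X - Y) <= nrm X + nrm Y.
Proof. by rewrite -(nrmN Y) nrmD_le. Qed.

Lemma nrmZ (z : C) X : nrm (z *: X) = cmod z * nrm X.
Proof. by rewrite !nrmE nsqZ sqrtrM ?sqr_ge0// sqrtr_sqr ger0_norm ?cmod_ge0. Qed.

Lemma nrm_sum_le (I : Type) (r : seq I) (P : pred I) (F : I -> 'M[C]_d) :
  nrm (\sum_(i <- r | P i) F i) <= \sum_(i <- r | P i) nrm (F i).
Proof.
elim/big_rec2 : _ => [|i y X _ h]; first by rewrite nrm0.
by apply: le_trans (nrmD_le _ _) _; rewrite lerD2l.
Qed.

Lemma nrm_le X Y : (nrm X <= nrm Y) = (nsq X <= nsq Y).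
Proof. rewrite !nrmE; by rewrite ler_psqrt// nnegrE nsq_ge0. Qed.

(* Operator norm at most 1, tested on matrices instead of vectors so that all
   estimates take place in the Hilbert-Schmidt norm. *)
Definition contr X := forall Y, nsq (X *m Y) <= nsq Y.

(** Pairing [Y] with [X *m (adj X *m Y)] produces twice [nsq (adj X *m Y)] on the left of
    [ip_le_nsq]; contractivity of [X] lets one of the two copies absorb the right side. *)
Lemma contr_adj X : contr X -> contr (adj X).
Proof.
move=> cX Y; have := ip_le_nsq Y (X *m (adj X *m Y)).
by rewrite ipC ip_mull -nsq_ip; have := cX (adj X *m Y); lra.
Qed.

Lemma contr_mulr X Y : contr X -> nsq (Y *m X) <= nsq Y.
Proof. by move=> /contr_adj h; rewrite -nsq_adj adj_mul -(nsq_adj Y). Qed.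

Lemma contr_mul X Y : contr X -> contr Y -> contr (X *m Y).
Proof. by move=> cX cY Z; rewrite -mulmxA (le_trans (cX _)). Qed.

Lemma isom_contr X : adj X *m X = 1%:M -> contr X.
Proof. by move=> XX Y; rewrite !nsq_ip ip_mull mulmxA XX mul1mx. Qed.

End Adjoint.

(** * Inverse square roots of positive definite matrices *)

Section InverseSqrt.
Local Open Scope sesquilinear_scope.

(** Positivity is phrased as a positive diagonal in every orthonormal basis, so an eigenbasis gives
    positive eigenvalues at once. The last clause makes [w] behave as a function of [z]: in an
    eigenbasis, a matrix commuting with [z] has nonzero entries only between equal eigenvalues. *)
Lemma inverse_sqrt_closed (F : numClosedFieldType) (n : nat) (z : 'M[F]_n) :
    z ^t* = z ->
    (forall P : 'M[F]_n, P *m P ^t* = 1%:M -> forall i, 0 < (P *m z *m P ^t*) i i) ->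
  exists w : 'M[F]_n, [/\ w ^t* = w, w *m z *m w = 1%:M &
    forall X, X *m z = z *m X -> X *m w = w *m X].
Proof.
move=> hz pz.
have /orthomx_spectral_subproof[[P sp] /= uP zE0] : z \is normalmx.
  by apply/normalmxP; rewrite hz.
have PP : P *m P ^t* = 1%:M by apply/unitarymxP.
have PP' : P ^t* *m P = 1%:M by apply: mulmx1C.
pose D := diag_mx sp.
have zE : z = P ^t* *m D *m P by rewrite zE0 invmx_unitary.
have DE : D = P *m z *m P ^t*.
  by rewrite zE !mulmxA PP mul1mx -mulmxA PP mulmx1.
have s0 i : 0 < sp 0 i.
  by have := pz P PP i; rewrite -DE mxE eqxx mulr1n.
pose f i := (sqrtC (sp 0 i))^-1.
have f0 i : 0 < f i by rewrite invr_gt0 sqrtC_gt0.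
pose E := diag_mx (\row_i f i).
have hE : E ^t* = E.
  apply/matrixP => i j; rewrite !mxE (eq_sym j i).
  case: eqP => [->|_]; rewrite ?mulr1n ?mulr0n ?conjC0//.
  by rewrite geC0_conj// ltW.
have EDE : E *m D *m E = 1%:M.
  apply/matrixP => i j; rewrite /E mul_mx_diag mul_diag_mx !mxE.
  case: eqP => [->|_]; last by rewrite mulr0n mulr0 mul0r.
  rewrite !mulr1n /f -{2}(sqrtCK (sp 0 j)).
  by field; rewrite sqrtC_eq0 gt_eqF.
exists (P ^t* *m E *m P); split.
- by rewrite !trmx_mul !map_mxM trmxCK hE mulmxA.
- rewrite zE; transitivity (P ^t* *m (E *m D *m E) *m P); last by rewrite EDE mulmx1.
  rewrite !mulmxA -(mulmxA _ P (P ^t*)) PP mulmx1.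
  by rewrite -(mulmxA _ P (P ^t*)) PP mulmx1.
move=> X Xz; have [Y YX] : exists Y, Y = P *m X *m P ^t* by eexists.
have YD : Y *m D = D *m Y.
  rewrite YX DE !mulmxA -(mulmxA _ (P ^t*) P) PP' mulmx1.
  by rewrite -(mulmxA _ (P ^t*) P) PP' mulmx1 -(mulmxA P) Xz mulmxA.
have YE : Y *m E = E *m Y.
  move: YD; rewrite /E /D !mul_mx_diag !mul_diag_mx => /matrixP YD.
  apply/matrixP => i j; have := YD i j; rewrite !mxE.
  have [->|Y0] := eqVneq (Y i j) 0; first by rewrite !(mul0r, mulr0).
  by rewrite mulrC => /(mulIf Y0) sij; rewrite mulrC /f sij.
have XE : X = P ^t* *m Y *m P.
  by rewrite YX !mulmxA PP' mul1mx -mulmxA PP' mulmx1.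
rewrite XE; transitivity (P ^t* *m (Y *m E) *m P).
  by rewrite !mulmxA -(mulmxA _ P (P ^t*)) PP mulmx1.
by rewrite YE !mulmxA -(mulmxA _ P (P ^t*)) PP mulmx1.
Qed.

End InverseSqrt.

(** * Commutants and averaging over them *)

Section Commutant.
Local Open Scope sesquilinear_scope.
Variables (R : realType) (d : nat).
Local Notation C := R[i].
Local Notation M := 'M[C]_d.
Implicit Types (X Y Z : M) (K S : M -> Prop).

Definition commutant K : M -> Prop := fun Y => forall X, K X -> Y *m X = X *m Y.
Definition adj_closed K := forall X, K X -> K (adj X).

Lemma commutant_adj K : adj_closed K -> adj_closed (commutant K).
Proof.
move=> hK Y hY X /hK KX; apply: (can_inj (@adjK R d)).
by rewrite !adj_mul adjK hY.
Qed.

Lemma commutantM K X Y : commutant K X -> commutant K Y -> commutant K (X *m Y).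
Proof. by move=> hX hY Z KZ; rewrite -mulmxA hY// !mulmxA hX. Qed.

Lemma commutantD K X Y : commutant K X -> commutant K Y -> commutant K (X + Y).
Proof. by move=> hX hY Z KZ; rewrite mulmxDl mulmxDr hX// hY. Qed.

Lemma commutantZ K (a : C) X : commutant K X -> commutant K (a *: X).
Proof. by move=> hX Z KZ; rewrite -scalemxAl -scalemxAr hX. Qed.

Lemma commutant0 K : commutant K 0.
Proof. by move=> Z KZ; rewrite mulmx0 mul0mx. Qed.

Lemma commutant1 K : commutant K 1%:M.
Proof. by move=> Z KZ; rewrite mulmx1 mul1mx. Qed.

Lemma commutant_sum K (I : Type) (r : seq I) (P : pred I) (F : I -> M) :
  (forall i, P i -> commutant K (F i)) -> commutant K (\sum_(i <- r | P i) F i).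
Proof. by move=> h; apply: big_ind => //; [exact: commutant0|exact: commutantD]. Qed.

(** [ip] keeps only the real part, which is enough for norms; expansion coefficients in a frame need
    the complex form. *)
Definition cip X Y : C := \tr (X *m adj Y).

Lemma cipDl X Y Z : cip (X + Y) Z = cip X Z + cip Y Z.
Proof. by rewrite /cip mulmxDl mxtraceD. Qed.

Lemma cipZl (a : C) X Y : cip (a *: X) Y = a * cip X Y.
Proof. by rewrite /cip -scalemxAl mxtraceZ. Qed.

Lemma cip_suml (I : Type) (r : seq I) (P : pred I) (F : I -> M) Z :
  cip (\sum_(i <- r | P i) F i) Z = \sum_(i <- r | P i) cip (F i) Z.
Proof.
apply: (big_morph (cip^~ Z)) => [X Y|]; first exact: cipDl.
by rewrite /cip mul0mx mxtrace0.
Qed.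

Lemma cipE X Y : cip X Y = \sum_i \sum_j X i j * conjc (Y i j).
Proof.
rewrite /cip /mxtrace; apply: eq_bigr => i _; rewrite mxE.
by apply: eq_bigr => j _; rewrite adjE.
Qed.

Lemma conj_cip X Y : conjc (cip X Y) = cip Y X.
Proof.
rewrite !cipE rmorph_sum; apply: eq_bigr => i _; rewrite rmorph_sum.
by apply: eq_bigr => j _; rewrite rmorphM /= conjcK mulrC.
Qed.

Lemma cip_self X : cip X X = (nsq X)%:C%C.
Proof.
rewrite nsqE cipE rmorph_sum; apply: eq_bigr => i _; rewrite rmorph_sum.
apply: eq_bigr => j _; rewrite cmod_sqr; case: (X i j) => a b /=.
apply/eqP; rewrite eq_complex /=; apply/andP; split; apply/eqP; ring.
Qed.

Lemma adj_trmxC X : adj X = X ^t*.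
Proof. by apply/matrixP => i j; rewrite adjE !mxE. Qed.

(** Stops the greedy construction in [parseval_frame]: flattened to rows, an orthonormal system is a
    matrix with orthonormal rows, hence of full row rank. *)
Lemma orthonormal_size (n : nat) (b : nat -> M) :
  (forall i j, (i < n)%N -> (j < n)%N -> cip (b i) (b j) = (i == j)%:R) ->
  (n <= d * d)%N.
Proof.
move=> hb.
pose U : 'M[C]_(n, d * d) := \matrix_(i, k) mxvec (b i) 0 k.
have uU : U \is unitarymx.
  apply/unitarymxP/matrixP => i j; rewrite !mxE.
  rewrite -(hb i j)// cipE pair_bigA /=.
  rewrite (reindex (uncurry (@mxvec_index d d))) /=; last exact: curry_mxvec_bij.
  by apply: eq_bigr => -[k l] _ /=; rewrite !mxE !mxvecE.
by rewrite -(mxrank_unitary uU) rank_leq_col.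
Qed.

(** [S] is a bare predicate with no dimension attached. If no finite orthonormal system in [S]
    reproduced all of [S], normalized residuals would extend such systems forever, against
    [orthonormal_size]. *)
Lemma parseval_frame S :
    (forall X Y, S X -> S Y -> S (X + Y)) -> (forall a X, S X -> S (a *: X)) ->
  exists (n : nat) (b : 'I_n -> M), (forall i, S (b i)) /\
    forall Y, S Y -> Y = \sum_i cip Y (b i) *: b i.
Proof.
move=> SaddS SscaleS; apply: contrapT => noframe.
suff H n : exists b : nat -> M, (forall i, (i < n)%N -> S (b i)) /\
    forall i j, (i < n)%N -> (j < n)%N -> cip (b i) (b j) = (i == j)%:R.
  have [b [_ /orthonormal_size]] := H (d * d).+1; by rewrite ltnn.
elim: n => [|n [b [Sb ob]]]; first by exists (fun=> 0).
have [Y [SY neq]] : exists Y, S Y /\ Y <> \sum_(i < n) cip Y (b i) *: b i.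
  apply: contrapT => no; apply: noframe; exists n, (fun i => b i); split.
    by move=> i; apply: Sb.
  by move=> Y SY; apply: contrapT => h; apply: no; exists Y.
pose r := Y - \sum_(i < n) cip Y (b i) *: b i.
have r0 : nsq r != 0.
  by apply/eqP => /nsq_eq0/eqP; rewrite subr_eq0 => /eqP.
have Sr : S r.
  apply: (SaddS _ _ SY); rewrite -scaleN1r; apply: (SscaleS).
  have S0 : S 0 by rewrite -(scale0r Y); apply: (SscaleS).
  by apply: big_ind => // i _; apply: (SscaleS); apply: Sb.
have orb j : (j < n)%N -> cip r (b j) = 0.
  move=> jn; rewrite /r -scaleN1r cipDl cipZl cip_suml (bigD1 (Ordinal jn))//=.
  rewrite cipZl ob// eqxx mulr1 big1 ?addr0 ?mulN1r ?subrr// => i ij.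
  by rewrite -val_eqE /= in ij; rewrite cipZl ob// (negbTE ij) mulr0.
pose c : C := ((Num.sqrt (nsq r))^-1)%:C%C.
have cc : c * conjc c * (nsq r)%:C%C = 1.
  rewrite /c conjc_real -!rmorphM /= -expr2 exprVn sqr_sqrtr ?nsq_ge0//.
  by rewrite mulVf.
have cipZr a X Z : cip X (a *: Z) = conjc a * cip X Z.
  by rewrite -conj_cip cipZl rmorphM /= conj_cip.
exists (fun i => if i == n then c *: r else b i); split.
  move=> i; rewrite ltnS leq_eqVlt; case: eqP => [_ _|_]; first exact: (SscaleS).
  exact: Sb.
move=> i j; rewrite !ltnS (leq_eqVlt i) (leq_eqVlt j).
case: (eqVneq i n) => [->|ni]; case: (eqVneq j n) => [->|nj] //= h1 h2.
- by rewrite cipZl cipZr cip_self mulrA cc ?eqxx.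
- by rewrite cipZl orb// mulr0.
- by rewrite cipZr -conj_cip orb// conjc0 mulr0 ?(negbTE ni).
- exact: ob.
Qed.

Lemma inverse_sqrt (z : M) : adj z = z ->
    (forall P : M, P *m adj P = 1%:M -> forall i, 0 < (P *m z *m adj P) i i) ->
  exists w : M, [/\ adj w = w, w *m z *m w = 1%:M &
    forall X, X *m z = z *m X -> X *m w = w *m X].
Proof.
move=> hz pz; have [] := @inverse_sqrt_closed _ d z.
- by rewrite -adj_trmxC.
- by move=> P PP i; have := pz P; rewrite adj_trmxC; apply.
move=> w [hw wzw cw]; exists w; split => //.
by rewrite adj_trmxC.
Qed.

(* [q] is [z^(-1/2) b] for a Parseval frame [b] of the commutant and the
   central element [z := sum b b^*]; the map [X |-> sum q X q^*] plays the role
   of averaging over the unitary group of the commutant. *)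
Lemma commutant_casimir K : adj_closed K ->
  exists (n : nat) (q : 'I_n -> M),
    [/\ forall i, commutant K (q i),
        \sum_i q i *m adj (q i) = 1%:M,
        \sum_i adj (q i) *m q i = 1%:M &
        forall X, commutant (commutant K) (\sum_i q i *m X *m adj (q i))].
Proof.
move=> hK; set S := commutant K.
have Sadj : adj_closed S by apply: commutant_adj.
have [n [b [Sb frame]]] := parseval_frame (@commutantD K) (@commutantZ K).
pose z := \sum_i b i *m adj (b i).
have Sz : S z.
  apply: commutant_sum => i _; apply: commutantM; first exact: Sb.
  by apply: (Sadj); apply: Sb.
have hz : adj z = z.
  by rewrite /z adj_sum; apply: eq_bigr => i _; rewrite adj_mul adjK.
(* Casimir argument: [Y *m b i] and [adj Y *m b j] both expand in the frame, with conjugate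
   coefficients, so [Y] moves from the left end to the right end. *)
have central X Y : S Y -> Y *m (\sum_i b i *m X *m adj (b i)) =
                          (\sum_i b i *m X *m adj (b i)) *m Y.
  move=> SY; rewrite mulmx_sumr mulmx_suml.
  transitivity (\sum_i \sum_j cip (Y *m b i) (b j) *: (b j *m X *m adj (b i))).
    apply: eq_bigr => i _; rewrite !mulmxA {1}[Y *m b i]frame; last exact: (commutantM SY (Sb i)).
    by rewrite !mulmx_suml; apply: eq_bigr => j _; rewrite -!scalemxAl.
  rewrite exchange_big; apply: eq_bigr => j _ /=.
  have -> : b j *m X *m adj (b j) *m Y = b j *m X *m adj (adj Y *m b j).
    by rewrite adj_mul adjK mulmxA.
  rewrite [adj Y *m b j]frame; last exact: (commutantM (Sadj _ SY) (Sb j)).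
  rewrite adj_sum mulmx_sumr; apply: eq_bigr => i _.
  rewrite adjZ -scalemxAr conj_cip; congr (_ *: _).
  by rewrite /cip adj_mul adjK -mulmxA mxtrace_mulC mulmxA.
(* The coefficient of [adj (b i)] at [b j] is the trace of [adj (b i) *m adj (b j)], which is
   symmetric in [i] and [j]. *)
have z' : \sum_i adj (b i) *m b i = z.
  transitivity (\sum_i \sum_j cip (adj (b i)) (b j) *: (b j *m b i)).
    apply: eq_bigr => i _; rewrite {1}[adj (b i)]frame; last exact: (Sadj _ (Sb i)).
    by rewrite mulmx_suml; apply: eq_bigr => j _; rewrite -scalemxAl.
  rewrite exchange_big; apply: eq_bigr => j _ /=.
  rewrite [adj (b j)]frame; last exact: (Sadj _ (Sb j)).
  rewrite mulmx_sumr; apply: eq_bigr => i _; rewrite -scalemxAr.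
  by congr (_ *: _); rewrite /cip mxtrace_mulC.
(* If this diagonal entry vanished, row [i] of [P] would annihilate every [b k], hence the identity,
   which lies in their span. *)
have pz P : P *m adj P = 1%:M -> forall i, 0 < (P *m z *m adj P) i i.
  move=> PP i.
  have PzE : (P *m z *m adj P) i i =
             (\sum_k \sum_j cmod ((P *m b k) i j) ^+ 2)%:C%C.
    rewrite mulmx_sumr mulmx_suml summxE rmorph_sum.
    apply: eq_bigr => k _; rewrite mulmxA -mulmxA -adj_mul mxE rmorph_sum.
    apply: eq_bigr => j _.
    rewrite adjE cmod_sqr; case: ((P *m b k) i j) => x y /=.
    apply/eqP; rewrite eq_complex /=; apply/andP; split; apply/eqP; ring.
  have s0 k : 0 <= \sum_j cmod ((P *m b k) i j) ^+ 2.
    by apply: sumr_ge0 => j _; rewrite sqr_ge0.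
  rewrite PzE ltcR lt_def sumr_ge0 // andbT; apply/eqP => /eqP.
  rewrite psumr_eq0// => /allP h0.
  have Pb k j : (P *m b k) i j = 0.
    have /= := h0 k (mem_index_enum _); rewrite psumr_eq0 => [/allP|? _]; last by rewrite sqr_ge0.
    by move=> /(_ j (mem_index_enum _)) /=; rewrite sqrf_eq0 => /eqP /Normc.eq0_normc.
  have Pi j : P i j = 0.
    rewrite -[P]mulmx1 [1%:M]frame; last exact: commutant1.
    rewrite mulmx_sumr summxE big1// => k _.
    by rewrite -scalemxAr mxE Pb mulr0.
  have /matrixP/(_ i i) := PP; rewrite !mxE eqxx big1 => [/eqP|j _]; last by rewrite Pi mul0r.
  by rewrite eq_sym oner_eq0.
have [w [hw wzw cw]] := inverse_sqrt hz pz.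
(* Taking the identity for [X] in [central] shows that [z] commutes with [S], hence so does [w];
   this is why one [w] normalizes both orders of multiplication. *)
have wb Y : S Y -> Y *m w = w *m Y.
  move=> SY; apply: cw; have := central 1%:M Y SY.
  by under eq_bigr do rewrite mulmx1.
have Sw : S w by move=> X KX; symmetry; apply: cw; rewrite Sz.
exists n, (fun i => w *m b i); split.
- by move=> i; apply: (commutantM Sw (Sb i)).
- rewrite -wzw /z mulmx_sumr mulmx_suml; apply: eq_bigr => i _.
  by rewrite adj_mul hw !mulmxA.
- rewrite -wzw -z' mulmx_sumr mulmx_suml; apply: eq_bigr => i _.
  rewrite adj_mul hw !mulmxA -(wb _ (Sadj _ (Sb i))) -!mulmxA.
  by rewrite (wb _ (Sb i)).
- move=> X Y SY; have := central X Y SY.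
  set T := \sum_i b i *m X *m adj (b i) => YT.
  have -> : \sum_i w *m b i *m X *m adj (w *m b i) = w *m T *m w.
    rewrite mulmx_sumr mulmx_suml; apply: eq_bigr => i _.
    by rewrite adj_mul hw !mulmxA.
  by rewrite -!mulmxA -(wb Y)// (mulmxA T) -YT !mulmxA (wb Y).
Qed.

End Commutant.

(** * Unital star-homomorphisms: embedded copies of full matrix algebras *)

Record star_morph (R : realType) (k d : nat) (f : 'M[R[i]]_k -> 'M[R[i]]_d) : Prop := {
  smD : forall X Y, f (X + Y) = f X + f Y;
  smZ : forall a X, f (a *: X) = a *: f X;
  smM : forall X Y, f (X *m Y) = f X *m f Y;
  sm1 : f 1%:M = 1%:M;
  smA : forall X, f (adj X) = adj (f X) }.

Section StarMorph.
Variables (R : realType) (k d : nat) (f : 'M[R[i]]_k -> 'M[R[i]]_d).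
Hypothesis fS : star_morph f.

Lemma sm0 : f 0 = 0.
Proof. by rewrite -(scale0r 0) smZ// scale0r. Qed.

Lemma smN X : f (- X) = - f X.
Proof. by rewrite -scaleN1r smZ// scaleN1r. Qed.

Lemma sm_sum (I : Type) (r : seq I) (P : pred I) (F : I -> 'M[R[i]]_k) :
  f (\sum_(i <- r | P i) F i) = \sum_(i <- r | P i) f (F i).
Proof. exact: (big_morph _ (smD fS) sm0). Qed.

Lemma sm_unitM a b c e :
  f (delta_mx a b) *m f (delta_mx c e) = if b == c then f (delta_mx a e) else 0.
Proof.
rewrite -smM// mul_delta_mx_cond; case: eqP => _; first by rewrite mulr1n.
by rewrite mulr0n sm0.
Qed.

Lemma adj_delta a b : adj (delta_mx a b : 'M[R[i]]_k) = delta_mx b a.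
Proof. by apply/matrixP => i j; rewrite adjE !mxE conjc_nat andbC. Qed.

Lemma sm_unitA a b : adj (f (delta_mx a b)) = f (delta_mx b a).
Proof. by rewrite -(smA fS) adj_delta. Qed.

Lemma sm_unit1 : \sum_a f (delta_mx a a) = 1%:M.
Proof. by rewrite -sm_sum -mx1_sum_delta (sm1 fS). Qed.

Lemma sm_coordE X : f X = \sum_a \sum_b X a b *: f (delta_mx a b).
Proof.
rewrite [X in LHS]matrix_sum_delta sm_sum; apply: eq_bigr => a _; rewrite sm_sum.
by apply: eq_bigr => b _; rewrite smZ.
Qed.

Lemma nsq_unit_mulr Y b : \sum_a nsq (Y *m f (delta_mx a b)) = nsq Y.
Proof.
transitivity (\sum_a ip Y (Y *m f (delta_mx a a))).
  by apply: eq_bigr => a _; rewrite nsq_ip ip_mulr sm_unitA -mulmxA sm_unitM eqxx.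
by rewrite -ip_sumr -mulmx_sumr sm_unit1 mulmx1 nsq_ip.
Qed.

Lemma nsq_unit_mull Y a : \sum_b nsq (f (delta_mx a b) *m Y) = nsq Y.
Proof.
rewrite -nsq_adj -(nsq_unit_mulr _ a); apply: eq_bigr => b _.
by rewrite -nsq_adj adj_mul sm_unitA.
Qed.

End StarMorph.

(** * Slices of a matrix and their stability under perturbation *)

Section Slices.
Variables (R : realType) (d : nat).
Local Notation M := 'M[R[i]]_d.

(** The hypothesis says that sending [Y] to the family of all [Y *m r c] is a contraction; the
    conclusion says the same of the adjoint map. The absorption argument is that of [contr_adj]. *)
Lemma row_contraction (I : finType) (r X : I -> M) :
    (forall Y, \sum_c nsq (Y *m r c) <= nsq Y) ->
  nsq (\sum_c X c *m adj (r c)) <= \sum_c nsq (X c).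
Proof.
set Y := \sum_c _ => hr.
have YE : nsq Y = \sum_c ip (X c) (Y *m r c).
  by rewrite nsq_ip {1}/Y ip_suml; apply: eq_bigr => c _; rewrite ip_mulr adjK.
have : 2 * nsq Y <= \sum_c (nsq (X c) + nsq (Y *m r c)).
  by rewrite YE mulr_sumr; apply: ler_sum => c _; apply: ip_le_nsq.
by rewrite big_split /=; have := hr Y; lra.
Qed.

Lemma nsq_mulr_partition (I : finType) (q : I -> M) (Y : M) :
  \sum_c q c *m adj (q c) = 1%:M -> \sum_c nsq (Y *m q c) = nsq Y.
Proof.
move=> q1; transitivity (\sum_c ip Y (Y *m (q c *m adj (q c)))).
  by apply: eq_bigr => c _; rewrite nsq_ip ip_mulr mulmxA.
by rewrite -ip_sumr -mulmx_sumr q1 mulmx1 nsq_ip.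
Qed.

(* [p a] is [sum_c x c a *m A' *m adj (x c a)], where [x c a] is the average of the
   matrix unit [(c, a)] over the commutant of [K]; by the gap hypothesis this
   commutant almost commutes with [iota], so [x c a] is close to the matrix unit. *)
Lemma slice_approx (k : nat) (iota : 'M[R[i]]_k -> M) (g : R) (A A' : M) (K : M -> Prop) :
    star_morph iota -> contr A -> adj_closed K -> 0 <= g ->
    commutant (commutant K) A' ->
    (forall q, exists2 y, (forall m, y *m iota m = iota m *m y) &
       nsq (q - y) <= g * (nsq (q *m A - A *m q) + nsq (q *m adj A - adj A *m q))) ->
  exists2 p : 'I_k -> M, (forall a, commutant (commutant K) (p a)) &
    \sum_a nsq (p a - \sum_c iota (delta_mx c a) *m A *m iota (delta_mx a c))
      <= (3 + 192 * g) * k%:R * nsq (A - A').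
Proof.
move=> iS cA hK g0 hA' gap.
have [n [q [Sq qq1 qq2 Phi]]] := commutant_casimir hK.
pose E a b := iota (delta_mx a b).
pose x c a := \sum_i q i *m E c a *m adj (q i).
have xS c a : commutant (commutant K) (x c a) by apply: Phi.
have xA c a : adj (x c a) = x a c.
  rewrite /x adj_sum; apply: eq_bigr => i _.
  by rewrite !adj_mul adjK sm_unitA// mulmxA.
have hS := commutant_adj hK.
have rq Y : \sum_c nsq (Y *m q c) <= nsq Y by rewrite nsq_mulr_partition.
(* For fixed [a] the averaged units still form a row contraction: split [Y] along the [q i], then
   along the matrix units, and recombine with [row_contraction]. *)
have rx a Y : \sum_c nsq (Y *m x c a) <= nsq Y.
  have -> : nsq Y = \sum_c \sum_i nsq (Y *m q i *m E c a).
    rewrite -(nsq_mulr_partition Y qq1) exchange_big /=.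
    by apply: eq_bigr => i _; rewrite nsq_unit_mulr.
  apply: ler_sum => c _; rewrite /x mulmx_sumr.
  under eq_bigr do rewrite mulmxA.
  apply: le_trans (row_contraction _ rq) _; apply: ler_sum => i _.
  by rewrite !mulmxA.
set D := A - A'.
(* [q i] commutes with [B'], so only [B - B'] contributes. The 4 is the 2 of [nsqD_le] times two
   sides of multiplication, each of which sums to [nsq (B - B')]. *)
have commD B B' : (forall i, q i *m B' = B' *m q i) ->
    \sum_i nsq (q i *m B - B *m q i) <= 4 * nsq (B - B').
  move=> qB; have : \sum_i nsq (q i *m B - B *m q i) <=
     \sum_i 2 * (nsq (q i *m (B - B')) + nsq ((B - B') *m q i)).
    apply: ler_sum => i _.
    have -> : q i *m B - B *m q i = q i *m (B - B') + - ((B - B') *m q i).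
      by rewrite mulmxBr mulmxBl qB opprB addrA subrK.
    by apply: le_trans (nsqD_le _ _) _; rewrite nsqN.
  rewrite -mulr_sumr big_split /= nsq_mulr_partition//.
  have -> : \sum_i nsq (q i *m (B - B')) = nsq (B - B'); last by lra.
  rewrite -nsq_adj -(nsq_mulr_partition (q := fun i => adj (q i))).
    by apply: eq_bigr => i _; rewrite -nsq_adj adj_mul.
  by under eq_bigr do rewrite adjK.
have qx : \sum_a \sum_c nsq (x c a - E c a) <= 32 * g * k%:R * nsq D.
  have xE c a : x c a - E c a = \sum_i (q i *m E c a - E c a *m q i) *m adj (q i).
    transitivity (x c a - \sum_i E c a *m (q i *m adj (q i))).
      by rewrite -mulmx_sumr qq1 mulmx1.
    by rewrite -sumrB; apply: eq_bigr => i _; rewrite mulmxBl -(mulmxA (E c a)).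
  have step1 : \sum_a \sum_c nsq (x c a - E c a) <=
               \sum_i \sum_a \sum_c nsq (q i *m E c a - E c a *m q i).
    rewrite [leRHS]exchange_big; apply: ler_sum => a _ /=.
    rewrite [leRHS]exchange_big; apply: ler_sum => c _ /=.
    by rewrite xE; apply: row_contraction.
  apply: le_trans step1 _.
  (* Subtracting [y], which commutes with every unit, leaves the small remainder [r]; the k^2 terms
     [nsq (r *m E c a)] add up to only k times [nsq r]. *)
  have step2 i : \sum_a \sum_c nsq (q i *m E c a - E c a *m q i) <=
     4 * k%:R * (g * (nsq (q i *m A - A *m q i) + nsq (q i *m adj A - adj A *m q i))).
    have [y yi hy] := gap (q i); set r := q i - y in hy.
    have -> : \sum_a \sum_c nsq (q i *m E c a - E c a *m q i) =
              \sum_a \sum_c nsq (r *m E c a - E c a *m r).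
      apply: eq_bigr => a _; apply: eq_bigr => c _; congr nsq.
      by rewrite /r mulmxBl mulmxBr yi opprB addrA subrK.
    apply: le_trans (_ : \sum_a \sum_c 2 * (nsq (r *m E c a) + nsq (E c a *m r)) <= _).
      apply: ler_sum => a _; apply: ler_sum => c _.
      by apply: le_trans (nsqD_le _ _) _; rewrite nsqN.
    have -> : \sum_a \sum_c 2 * (nsq (r *m E c a) + nsq (E c a *m r)) =
              4 * k%:R * nsq r.
      under eq_bigr do rewrite -mulr_sumr big_split /= nsq_unit_mulr//.
      rewrite -mulr_sumr big_split /= exchange_big /=.
      under [X in _ + X]eq_bigr do rewrite nsq_unit_mull//.
      by rewrite !sumr_const card_ord -mulr_natl; ring.
    by rewrite ler_wpM2l// mulr_ge0// ler0n.
  apply: le_trans (ler_sum _ (fun i _ => step2 i)) _.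
  rewrite -!mulr_sumr big_split /=.
  have := commD A A' (fun i => esym (hA' _ (Sq i))).
  have := commD (adj A) (adj A') (fun i => esym (commutant_adj hS hA' (Sq i))).
  rewrite -adjB nsq_adj -/D.
  set u := \sum_i _; set v := \sum_i _ => hu hv.
  have -> : 32 * g * k%:R * nsq D = 4 * k%:R * (g * (4 * nsq D + 4 * nsq D)) by ring.
  by rewrite ler_wpM2l ?mulr_ge0 ?ler0n// ler_wpM2l// lerD.
exists (fun a => \sum_c x c a *m A' *m x a c).
  move=> a; apply: commutant_sum => c _; apply: commutantM => //.
  exact: commutantM.
(* Telescoping from the slice of [A'] by [x] to the slice of [A] by [E], one factor at a time, so
   that each difference is multiplied by a contractive row. With the 3 of [nsqD3_le] the total is 3
   * (1 + 32 g + 32 g) = 3 + 192 g. *)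
pose T1 a := \sum_c x c a *m (A' - A) *m adj (x c a).
pose T2 a := \sum_c (x c a - E c a) *m A *m adj (x c a).
pose T3 a := \sum_c E c a *m A *m adj (x c a - E c a).
have dec a : \sum_c x c a *m A' *m x a c - \sum_c E c a *m A *m E a c =
             T1 a + T2 a + T3 a.
  rewrite -!big_split -sumrB; apply: eq_bigr => c _ /=.
  rewrite adjB xA /E sm_unitA// -/(E c a) -/(E a c).
  rewrite !mulmxBr !mulmxBl.
  move: (x c a *m A' *m _) (x c a *m A *m _) (E c a *m A *m x a c) (E c a *m A *m _).
  by move=> a1 a2 a3 a4; rewrite !addrA !subrK.
have b1 : \sum_a nsq (T1 a) <= k%:R * nsq D.
  apply: le_trans (_ : \sum_a \sum_c nsq (x c a *m (A' - A)) <= _).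
    by apply: ler_sum => a _; apply: row_contraction.
  rewrite exchange_big /=.
  apply: le_trans (_ : \sum_(c < k) nsq D <= _); last first.
    by rewrite sumr_const card_ord mulr_natl.
  apply: ler_sum => c _.
  have -> : nsq D = nsq (adj (A' - A)) by rewrite nsq_adj -nsqN opprB.
  apply: le_trans (rx c _); apply: ler_sum => a _.
  by rewrite -nsq_adj adj_mul xA.
have cAa := contr_adj cA.
have b2 : \sum_a nsq (T2 a) <= 32 * g * k%:R * nsq D.
  apply: le_trans qx; apply: ler_sum => a _.
  apply: le_trans (row_contraction _ (rx a)) _; apply: ler_sum => c _.
  exact: contr_mulr.
have b3 : \sum_a nsq (T3 a) <= 32 * g * k%:R * nsq D.
  apply: le_trans qx; apply: ler_sum => a _.
  rewrite -nsq_adj /T3 adj_sum.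
  have -> : \sum_c adj (E c a *m A *m adj (x c a - E c a)) =
            \sum_c ((x c a - E c a) *m adj A) *m adj (E c a).
    by apply: eq_bigr => c _; rewrite !adj_mul adjK mulmxA.
  apply: le_trans (row_contraction _ _) _ => [Y|]; first by rewrite nsq_unit_mulr.
  by apply: ler_sum => c _; apply: contr_mulr.
apply: le_trans (_ : \sum_a 3 * (nsq (T1 a) + nsq (T2 a) + nsq (T3 a)) <= _).
  by apply: ler_sum => a _; rewrite dec nsqD3_le.
rewrite -mulr_sumr !big_split /=.
have -> : (3 + 192 * g) * k%:R * nsq D = 3 * (k%:R * nsq D + 32 * g * k%:R * nsq D
   + 32 * g * k%:R * nsq D) by ring.
by rewrite ler_wpM2l// !lerD.
Qed.

End Slices.

(** * Signed residues modulo N *)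

Section SignedResidue.
Variable m : nat.
Local Notation N := m.+2.
Implicit Types x y : 'I_N.

(** The representative in (-N/2, N/2]: near the origin, where no carry occurs, the torus then looks
    like a piece of the integer lattice. *)
Definition sres x : int := if (x.*2 <= N)%N then x%:Z else x%:Z - N%:Z.

Lemma sresP x : (sres x = x%:Z /\ (x.*2 <= N)%N) \/ (sres x = x%:Z - N%:Z /\ (N < x.*2)%N).
Proof. by rewrite /sres; case: leqP; [left|right]. Qed.

Lemma sres_bound x : - N%:Z < 2 * sres x <= N%:Z.
Proof. have := ltn_ord x; case: (sresP x) => -[-> h]; lia. Qed.

Lemma sres_eq0 x : sres x = 0 -> x = 0.
Proof.
move=> h; apply: val_inj => /=; move: h; have := ltn_ord x.
case: (sresP x) => -[-> h] xN; lia.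
Qed.

Lemma valDP x y : ((x + y)%R : nat) = (x + y)%N \/ (x + y)%N = ((x + y)%R + N)%N.
Proof.
have xN := ltn_ord x; have yN := ltn_ord y.
rewrite /=; have [h|h] := ltnP (x + y) N; first by left; rewrite modn_small.
right; rewrite -{2}(subnK h) modnDr modn_small ?subnK//; lia.
Qed.

Lemma sresD x y : [\/ sres (x + y) = sres x + sres y,
  sres (x + y) = sres x + sres y - N%:Z | sres (x + y) = sres x + sres y + N%:Z].
Proof.
have xN := ltn_ord x; have yN := ltn_ord y; have zN := ltn_ord (x + y).
move: (valDP x y); move: (x + y) zN => z zN h.
case: (sresP x) => -[-> hx]; case: (sresP y) => -[-> hy];
  case: (sresP z) => -[-> hz]; case: h => h; first
  [by apply: Or31; lia|by apply: Or32; lia|by apply: Or33; lia|exfalso; lia].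
Qed.

Lemma sresN x : sres (- x) = - sres x \/ sres (- x) = N%:Z - sres x.
Proof.
have := sresD x (- x); rewrite subrr.
have -> : sres 0 = 0 by rewrite /sres.
have := sres_bound x; have := sres_bound (- x) => h1 h2.
by case => h; [left|right|left]; lia.
Qed.

End SignedResidue.

(** * A spectral gap on the discrete torus *)

Section Torus.
Variables (R : realType) (m : nat).
Local Notation N := m.+2.
Local Notation X := ('I_N * 'I_N)%type.
Implicit Types x y : X.

(** The shift by twice the first coordinate comes from the chirp, as (x + a)^2 - x^2 = 2ax + a^2. It
    is also large enough to push the double sector out of itself. *)
Definition shear x : X := (x.1, x.2 - (x.1 + x.1)).
Definition unshear x : X := (x.1, x.2 + (x.1 + x.1)).
Definition rot x : X := (- x.2, x.1).

(** The threshold N/6 serves twice. Below it, b + 2a and b - 2a stay within N/2 and do not wrap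
    around; beyond it, the angle of [chi a] is at least pi/3 away from 0, so that [chi a] has
    distance at least 1 from 1. *)
Definition far (a : 'I_N) : bool := (N%:Z <= 6 * sres a) || (6 * sres a <= - N%:Z).

(* Together with its image under [rot], the double sector [sector] partitions
   the nonzero vectors; near the origin both shears push it into that image,
   and they do so with disjoint ranges. *)
Definition sector x : bool :=
  let s := sres x.1 in let t := sres x.2 in
  ((0 < s) && (- s < t <= s)) || ((s < 0) && (s <= t < - s)).

Lemma shearK : cancel shear unshear.
Proof. by case=> a b; rewrite /shear /unshear /= subrK. Qed.

Lemma unshearK : cancel unshear shear.
Proof. by case=> a b; rewrite /shear /unshear /= addrK. Qed.

Lemma rot_inj : injective rot.
Proof.
move=> [a b] [c e] h; have /oppr_inj /= be := congr1 fst h.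
by have /= ac := congr1 snd h; rewrite be ac.
Qed.

Lemma sector_rot x : x != 0 -> ~~ sector x -> sector (rot x).
Proof.
case: x => a b nz; rewrite /sector /rot /=.
have := sres_bound a; have := sres_bound b.
have : sres a <> 0 \/ sres b <> 0.
  have [a0|a0] := eqVneq a 0; last by left => /sres_eq0 h; rewrite h eqxx in a0.
  have [b0|b0] := eqVneq b 0; last by right => /sres_eq0 h; rewrite h eqxx in b0.
  by rewrite a0 b0 eqxx in nz.
case: (sresN b) => ->; lia.
Qed.

Lemma far_opp (a : 'I_N) : far (- a) = far a.
Proof. by rewrite /far; have := sres_bound a; have := sres_bound (- a); case: (sresN a) => ->; lia. Qed.

Definition near_sector x := [&& sector x, ~~ far x.1 & ~~ far x.2].

(** Adding the two indicators states at once that the images under the shears are disjoint and that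
    both avoid the sector. For first coordinate s > 0 they lie in the strips -3s < t <= -s and s < t
    <= 3s. *)
Lemma near_sector_shears x :
  ((near_sector (unshear x) + near_sector (shear x)) <=
   ((x != 0%R) && ~~ sector x))%N.
Proof.
case: x => a b.
have -> : ((a, b) != 0 :> X) = ((sres a != 0) || (sres b != 0)).
  have e (z : 'I_N) : (sres z == 0) = (z == 0).
    by apply/eqP/eqP => [/sres_eq0|->]; rewrite /sres.
  by rewrite !e xpair_eqE negb_and.
have [fa|] := boolP (far a); first by rewrite /near_sector /= fa !andbF.
rewrite /near_sector /sector /shear /unshear /far /= => fa.
have ba := sres_bound a; have baa := sres_bound (a + a).
have a2 : sres (a + a) = 2 * sres a by case: (sresD a a) => h; lia.
have := sres_bound b.
have := sres_bound (b + (a + a)); have := sres_bound (b - (a + a)).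
have := sresD (b - (a + a)) (a + a); rewrite subrK.
have := sresD b (a + a); rewrite a2.
move: fa ba; clear.
move: (sres (b + (a + a))) (sres (b - (a + a))) (sres a) (sres b) => u v s t fa ba.
by move=> [->|->|->] [h|h|h] h1 h2 h3; lia.
Qed.

(** The origin is fixed by both maps and not far, so a mass there is the one obstruction, excluded
    by [G 0 = 0]. Elsewhere the mass runs in a loop: rotation bounds the complement by 5/4 of the
    sector, and the two disjoint shears bound the near sector by 5/8 of the complement. The weight
    5/4 in [young] is chosen so that 25/32 < 1 closes the loop; 100 rounds up the resulting
    constants. *)
Lemma torus_gap (G : X -> R) : G 0 = 0 ->
  \sum_x G x ^+ 2 <= 100 * (\sum_(x | far x.1) G x ^+ 2
    + \sum_x (G (shear x) - G x) ^+ 2 + \sum_x (G (rot x) - G x) ^+ 2).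
Proof.
move=> G0; pose W (P : pred X) := \sum_(x | P x) G x ^+ 2.
have W0 P : 0 <= W P by apply: sumr_ge0 => x _; rewrite sqr_ge0.
set eZ := \sum_(x | far x.1) _; set eT := \sum_x (G (shear x) - _) ^+ 2.
set eR := \sum_x (G (rot x) - _) ^+ 2.
pose V := [pred x | (x != 0) && ~~ sector x].
have young (a b : R) : a ^+ 2 <= 5 / 4 * b ^+ 2 + 5 * (b - a) ^+ 2.
  by have := sqr_ge0 (5 * b - 4 * a); nra.
have Wrot P : W P = \sum_(x | P (rot x)) G (rot x) ^+ 2.
  by rewrite /W (reindex_inj rot_inj).
have restr (P : pred X) (F : X -> R) :
    (forall x, 0 <= F x) -> \sum_(x | P x) F x <= \sum_x F x.
  by move=> F0; rewrite [leRHS](bigID P) /= lerDl sumr_ge0.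
have young_sum (P : pred X) (f : X -> X) :
    W P <= 5 / 4 * \sum_(x | P x) G (f x) ^+ 2 + 5 * \sum_x (G (f x) - G x) ^+ 2.
  apply: le_trans (_ : \sum_(x | P x)
     (5 / 4 * G (f x) ^+ 2 + 5 * (G (f x) - G x) ^+ 2) <= _).
    by apply: ler_sum => x _; apply: young.
  rewrite big_split /= -!mulr_sumr lerD2l ler_pM2l// restr// => x.
  exact: sqr_ge0.
have mono (P Q : pred X) (F : X -> R) : (forall x, 0 <= F x) ->
    (forall x, P x -> Q x) -> \sum_(x | P x) F x <= \sum_(x | Q x) F x.
  move=> F0 PQ; rewrite [leLHS]big_mkcond [leRHS]big_mkcond /=.
  apply: ler_sum => x _; case: ifP => [/PQ->//|_].
  by case: ifP.
have s2 x : 0 <= G x ^+ 2 by rewrite sqr_ge0.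
have h1 : W [pred x | far x.2] <= 5 / 4 * eZ + 5 * eR.
  apply: le_trans (young_sum _ rot) _; rewrite lerD2r ler_pM2l//.
  rewrite /eZ -/(W [pred x | far x.1]) Wrot; apply: mono => x /=; first exact: sqr_ge0.
  by rewrite far_opp.
have h2 : W V <= 5 / 4 * W sector + 5 * eR.
  apply: le_trans (young_sum _ rot) _; rewrite lerD2r ler_pM2l//.
  rewrite Wrot; apply: mono => x /=; first exact: sqr_ge0.
  by move=> /andP[]; apply: sector_rot.
have h3 : 2 * W near_sector <= 5 / 4 * W V + 10 * eT.
  have t1 := young_sum near_sector shear; rewrite -/eT in t1.
  have t2 := young_sum near_sector unshear.
  have eT' : \sum_x (G (unshear x) - G x) ^+ 2 = eT.
    rewrite (reindex_inj (can_inj shearK)) /=; apply: eq_bigr => x _.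
    by rewrite shearK -sqrrN opprB.
  rewrite eT' in t2.
  suff : \sum_(x | near_sector x) G (shear x) ^+ 2 +
         \sum_(x | near_sector x) G (unshear x) ^+ 2 <= W V by lra.
  rewrite [X in X + _](reindex_inj (can_inj unshearK)).
  rewrite [X in _ + X](reindex_inj (can_inj shearK)) /=.
  rewrite big_mkcond [X in _ + X]big_mkcond -big_split /W [leRHS]big_mkcond /=.
  apply: ler_sum => x _; rewrite unshearK shearK.
  have := near_sector_shears x.
  by case: (near_sector _); case: (near_sector _); case: (_ && _) => //= _;
    rewrite ?addr0 ?add0r ?s2.
have h4 : W sector <= W near_sector + eZ + W [pred x | far x.2].
  rewrite /eZ -/(W [pred x | far x.1]) /W [leLHS]big_mkcond /=.
  rewrite [X in X + _ + _]big_mkcond [X in _ + X + _]big_mkcond [X in _ + X]big_mkcond /=.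
  rewrite -!big_split /=; apply: ler_sum => x _; rewrite /near_sector.
  have := s2 x; case: (sector x); case: (far x.1); case: (far x.2) => /=; lra.
have h5 : \sum_x G x ^+ 2 <= W sector + W V.
  rewrite /W [X in _ <= X + _]big_mkcond [X in _ <= _ + X]big_mkcond -big_split /=.
  apply: ler_sum => x _; have := s2 x.
  have [->|x0] := eqVneq x 0; first by rewrite G0 expr0n /= ?if_same ?addr0.
  by case: (sector x) => /=; lra.
have := W0 near_sector; have := W0 sector; have := W0 V.
have : 0 <= eZ by apply: W0.
have : 0 <= eT by apply: sumr_ge0 => x _; apply: sqr_ge0.
have : 0 <= eR by apply: sumr_ge0 => x _; apply: sqr_ge0.
lra.
Qed.

End Torus.

(** * Cosine bounds for roots of unity *)

Section Trig.
Variable R : realType.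

Lemma cos_pi3 : cos (pi / 3) = 2^-1 :> R.
Proof.
have p0 : 0 < pi :> R := pi_gt0 R.
set t : R := pi / 3; have c0 : 0 < cos t by apply: cos_gt0_pihalf; rewrite /t; lra.
have : cos (t + (t + t)) = -1 by rewrite -(cospi R); congr cos; rewrite /t; lra.
rewrite !cosD sinD; have := cos2Dsin2 t; set c := cos t in c0 *; set s := sin t => cs h.
(* Triple angle: cos 3t = -1 reads 4c^3 - 3c + 1 = (c + 1)(2c - 1)^2 = 0, and c is positive. *)
have : (c + 1) * (2 * c - 1) ^+ 2 = 0 by nra.
by move=> /eqP; rewrite mulf_eq0 sqrf_eq0 => /orP[] /eqP; lra.
Qed.

Lemma cos_2piB (t : R) : cos (pi *+ 2 - t) = cos t.
Proof. by rewrite cosB cos2pi sin2pi mul1r mul0r addr0. Qed.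

Lemma cos_lt1 (t : R) : 0 < t < pi *+ 2 -> cos t < 1.
Proof.
have p0 : 0 < pi :> R := pi_gt0 R.
wlog tp : t / t <= pi => [H|] /andP[t0 t2].
  have [tp|tp] := leP t pi; first by apply: H => //; rewrite t0.
  by rewrite -cos_2piB; apply: H; lra.
by rewrite -(cos0 R) ltr_cos// in_itv /=; lra.
Qed.

Lemma cos_le_half (t : R) : pi / 3 <= t <= 5 * (pi / 3) -> cos t <= 2^-1.
Proof.
have p0 : 0 < pi :> R := pi_gt0 R.
wlog tp : t / t <= pi => [H|] /andP[t0 t2].
  have [tp|tp] := leP t pi; first by apply: H => //; rewrite t0.
  by rewrite -cos_2piB; apply: H; lra.
rewrite -cos_pi3; move: t0; rewrite le_eqVlt => /predU1P[<-//|t0].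
by rewrite ltW// ltr_cos// in_itv /=; lra.
Qed.

End Trig.

(** * Discrete Fourier analysis of N by N matrices *)

Section Characters.
Variables (R : realType) (m : nat).
Local Notation N := m.+2.
Local Notation C := R[i].
Implicit Types a b x y : 'I_N.

Definition angle (k : nat) : R := (pi *+ 2) / N%:R * k%:R.
Definition chi x : C := (cos (angle x) +i* sin (angle x))%C.

Lemma angleD j k : angle (j + k)%N = angle j + angle k.
Proof. by rewrite /angle natrD mulrDr. Qed.

Lemma angleN : angle N = pi *+ 2.
Proof. by rewrite /angle divfK// pnatr_eq0. Qed.

Lemma chiD x y : chi (x + y) = chi x * chi y.
Proof.
rewrite /chi; have E j k : ((cos (angle j) +i* sin (angle j)) *
    (cos (angle k) +i* sin (angle k)) =
    cos (angle (j + k)%N) +i* sin (angle (j + k)%N))%C.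
  rewrite angleD cosD sinD; apply/eqP; rewrite eq_complex /=.
  by apply/andP; split; apply/eqP; ring.
rewrite E; case: (valDP x y) => -> //.
by rewrite angleD angleN (cosD2pi _) (sinD2pi _).
Qed.

Lemma chi0 : chi 0 = 1.
Proof. by rewrite /chi /angle /= mulr0 cos0 sin0. Qed.

Lemma cmod_chi x : cmod (chi x) ^+ 2 = 1.
Proof. by rewrite cmod_sqr /= cos2Dsin2. Qed.

Lemma chi_conj x : conjc (chi x) = chi (- x).
Proof.
have h : conjc (chi x) * chi x = 1.
  rewrite /chi /=; apply/eqP; rewrite eq_complex /=; apply/andP; split; apply/eqP.
    by have := cos2Dsin2 (angle x); rewrite !expr2 => <-; ring.
  ring.
have : chi x * chi (- x) = 1 by rewrite -chiD subrr chi0.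
by move=> h2; rewrite -[LHS]mulr1 -h2 mulrA h mul1r.
Qed.

Lemma angle_bound x : x != 0 -> 0 < angle x < pi *+ 2.
Proof.
move=> x0; rewrite -angleN /angle.
have p0 : 0 < (pi *+ 2) / N%:R :> R by rewrite divr_gt0 ?ltr0n// pmulrn_lgt0// pi_gt0.
rewrite mulr_gt0 ?ltr0n ?lt0n//= ltr_pM2l// ltr_nat; exact: ltn_ord.
Qed.

Lemma chi_neq1 x : x != 0 -> chi x != 1.
Proof.
move=> /angle_bound/cos_lt1 h; apply/eqP => /(congr1 (@complex.Re R)) /= e.
by rewrite e ltxx in h.
Qed.

Lemma far_chi a : far a -> 1 <= cmod (chi a - 1) ^+ 2.
Proof.
move=> fa; have h : cos (angle a) <= 2^-1.
  apply: cos_le_half; rewrite /angle.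
  have N0 : 0 < N%:R :> R by rewrite ltr0n.
  have [l r] : (N <= 6 * a)%N /\ (6 * a <= 5 * N)%N.
    have := ltn_ord a; move: fa; rewrite /far; case: (sresP a) => -[-> ?]; lia.
  have lR : N%:R <= 6 * a%:R :> R by rewrite -natrM ler_nat.
  have rR : 6 * a%:R <= 5 * N%:R :> R by rewrite -!natrM ler_nat.
  have p0 : 0 < pi :> R := pi_gt0 R.
  have -> : pi *+ 2 / N%:R * a%:R = (pi / 3) * (6 * a%:R / N%:R) :> R.
    by rewrite -mulr_natl; field; rewrite gt_eqF.
  have p3 : 0 < pi / 3 :> R by lra.
  rewrite -{1}[pi / 3]mulr1 ler_pM2l// [5 * _]mulrC ler_pM2l//.
  by rewrite ler_pdivlMr// mul1r lR ler_pdivrMr.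
rewrite cmod_sqr /=; have := cos2Dsin2 (angle a); nra.
Qed.

Lemma sum_chi a : \sum_x chi (x * a) = (a == 0)%:R * N%:R.
Proof.
have [->|a0] := eqVneq a 0.
  under eq_bigr do rewrite mulr0 chi0.
  by rewrite sumr_const card_ord mul1r.
rewrite mul0r; set S := \sum_x _.
have : S * chi a = S.
  rewrite /S mulr_suml [RHS](reindex_inj (addIr (1 : 'I_N))) /=.
  by apply: eq_bigr => x _; rewrite mulrDl mul1r chiD.
move=> /eqP; rewrite -subr_eq0 -{2}[S]mulr1 -mulrBr mulf_eq0 subr_eq0.
by rewrite (negbTE (chi_neq1 a0)) orbF => /eqP.
Qed.

Definition rootN : C := ((Num.sqrt N%:R)^-1)%:C%C.

Lemma rootN_sqr : rootN * rootN * N%:R = 1.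
Proof.
have -> : (N%:R : C) = (N%:R : R)%:C%C by rewrite rmorph_nat.
by rewrite -!rmorphM /= -expr2 exprVn sqr_sqrtr ?ler0n// mulVf//.
Qed.

Lemma rootN_conj : conjc rootN = rootN.
Proof. exact: conjc_real. Qed.

Lemma conjcM (u w : C) : conjc (u * w) = conjc u * conjc w.
Proof. exact: rmorphM. Qed.

Lemma conjc_sum (F : 'I_N -> C) : conjc (\sum_x F x) = \sum_x conjc (F x).
Proof. exact: rmorph_sum. Qed.

Definition dft (u : 'I_N -> C) b : C := rootN * \sum_x chi (- (b * x)) * u x.

Lemma csqE (z : C) : (cmod z ^+ 2)%:C%C = z * conjc z.
Proof.
rewrite cmod_sqr; case: z => a b; apply/eqP; rewrite eq_complex /=.
by apply/andP; split; apply/eqP; ring.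
Qed.

Lemma dft_parseval (u : 'I_N -> C) :
  \sum_b cmod (dft u b) ^+ 2 = \sum_x cmod (u x) ^+ 2.
Proof.
apply: (@complexI R); rewrite !rmorph_sum /=.
under eq_bigr do rewrite csqE; under [RHS]eq_bigr do rewrite csqE.
have e b : dft u b * conjc (dft u b) =
    \sum_x \sum_y rootN * rootN * (u x * conjc (u y)) * chi (b * (y - x)).
  rewrite /dft conjcM conjc_sum rootN_conj mulrACA mulr_suml mulr_sumr.
  apply: eq_bigr => x _; rewrite !mulr_sumr; apply: eq_bigr => y _.
  rewrite conjcM chi_conj opprK mulrBr chiD; ring.
under eq_bigr do rewrite e.
rewrite exchange_big; apply: eq_bigr => x _ /=; rewrite exchange_big /=.
under eq_bigr do rewrite -mulr_sumr sum_chi subr_eq0.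
rewrite (bigD1 x)//= eqxx mul1r big1 => [|y /negbTE->]; last by rewrite mul0r mulr0.
by rewrite addr0 mulrAC rootN_sqr mul1r.
Qed.

Implicit Types q : 'M[C]_N.

(** Coefficients in the Weyl basis: [a] selects a cyclic diagonal and [b] a frequency along it. *)
Definition ft q a b : C := dft (fun x => q x (x + a)) b.

Lemma ft_parseval q : \sum_(z : 'I_N * 'I_N) cmod (ft q z.1 z.2) ^+ 2 = nsq q.
Proof.
rewrite -(pair_bigA _ (fun a b => cmod (ft q a b) ^+ 2)) /= nsqE.
under eq_bigr do rewrite dft_parseval.
rewrite exchange_big; apply: eq_bigr => x _ /=.
by rewrite [RHS](reindex_inj (addrI x)).
Qed.

Lemma ftB q q' a b : ft (q - q') a b = ft q a b - ft q' a b.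
Proof.
rewrite /ft /dft -mulrBr -sumrB; congr (_ * _); apply: eq_bigr => x _.
by rewrite !mxE mulrBr.
Qed.

Definition clockmx : 'M[C]_N := diag_mx (\row_x chi x).
Definition chirpmx : 'M[C]_N := diag_mx (\row_x chi (x * x)).
Definition fouriermx : 'M[C]_N := \matrix_(x, y) (rootN * chi (x * y)).

Lemma diag_chi_isom (h : 'I_N -> 'I_N) :
  let D : 'M[C]_N := diag_mx (\row_x chi (h x)) in adj D *m D = 1%:M.
Proof.
move=> D; apply/matrixP => x y; rewrite mul_mx_diag !mxE (eq_sym y x).
case: eqP => [_|_]; last by rewrite mulr0n conjc0 mul0r.
by rewrite mulr1n chi_conj -chiD addNr chi0.
Qed.

Lemma clock_isom : adj clockmx *m clockmx = 1%:M.
Proof. exact: (diag_chi_isom id). Qed.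

Lemma chirp_isom : adj chirpmx *m chirpmx = 1%:M.
Proof. exact: (diag_chi_isom (fun x => x * x)). Qed.

Lemma fourier_isom : adj fouriermx *m fouriermx = 1%:M.
Proof.
apply/matrixP => x y; rewrite !mxE.
under eq_bigr => z _ do rewrite adjE !mxE conjcM rootN_conj chi_conj mulrACA -chiD.
have -> : (x == y) = (y - x == 0) by rewrite subr_eq0 eq_sym.
rewrite -mulr_sumr.
under eq_bigr => z _ do rewrite addrC -mulrBr.
by rewrite sum_chi mulrCA rootN_sqr mulr1.
Qed.

Lemma ft_clock q a b : ft (adj clockmx *m q *m clockmx) a b = chi a * ft q a b.
Proof.
rewrite /ft /dft [RHS]mulrCA; congr (_ * _); rewrite mulr_sumr; apply: eq_bigr => x _.
rewrite mul_mx_diag mxE.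
have -> : adj clockmx = diag_mx (\row_x chi (- x)).
  apply/matrixP => i j; rewrite adjE !mxE (eq_sym j i).
  by case: eqP => [->|_]; rewrite ?mulr1n ?mulr0n ?chi_conj ?conjc0.
rewrite mul_diag_mx !mxE chiD -[in RHS](mul1r (q _ _)) -chi0 -(addNr x) chiD; ring.
Qed.

Lemma ft_chirp q a b :
  ft (adj chirpmx *m q *m chirpmx) a b = chi (a * a) * ft q a (b - (a + a)).
Proof.
rewrite /ft /dft [RHS]mulrCA; congr (_ * _); rewrite mulr_sumr; apply: eq_bigr => x _.
rewrite mul_mx_diag mxE.
have -> : adj chirpmx = diag_mx (\row_x chi (- (x * x))).
  apply/matrixP => i j; rewrite adjE !mxE (eq_sym j i).
  by case: eqP => [->|_]; rewrite ?mulr1n ?mulr0n ?chi_conj ?conjc0.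
rewrite mul_diag_mx !mxE !(mulrA, mulrAC _ (q x _)); congr (_ * _).
by rewrite -!chiD; congr chi; ring.
Qed.

Lemma ft_fourier q a b :
  ft (fouriermx *m q *m adj fouriermx) a b = chi (a * b) * ft q (- b) a.
Proof.
rewrite /ft /dft [RHS]mulrCA; congr (_ * _).
(* With everything expanded, the sum over the row index [u] of the conjugated matrix is a character
   sum that forces y = x - b. *)
transitivity (\sum_x \sum_y \sum_u rootN * rootN * q x y * chi (- (a * y)) *
   chi (u * (x - y - b))).
  rewrite exchange_big /= (eq_bigr _ (fun y _ => exchange_big _ _ _ _ _ _)) /=.
  rewrite exchange_big /=; apply: eq_bigr => u _.
  rewrite mxE mulr_sumr; apply: eq_bigr => y _; rewrite mxE mulr_suml mulr_sumr.
  apply: eq_bigr => x _; rewrite adjE !mxE conjcM rootN_conj chi_conj.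
  have -> : chi (u * (x - y - b)) = chi (u * x) * chi (- (u * y)) * chi (- (b * u)).
    by rewrite -!chiD; congr chi; ring.
  have -> : chi (- ((u + a) * y)) = chi (- (u * y)) * chi (- (a * y)).
    by rewrite -!chiD; congr chi; ring.
  ring.
rewrite mulr_sumr; apply: eq_bigr => x _.
under eq_bigr do rewrite -mulr_sumr sum_chi.
rewrite (bigD1 (x - b))//= big1 => [|y yx]; last first.
  rewrite subr_eq0 (_ : (x - y == b) = false) ?mul0r ?mulr0//.
  by apply/negbTE; apply: contra yx => /eqP <-; rewrite opprB addrC subrK.
rewrite addr0 opprB addrCA subrr addr0 subrr eqxx mul1r.
have -> : - (a * (x - b)) = a * b - a * x by ring.
rewrite chiD; transitivity (rootN * rootN * N%:R *
   (chi (a * b) * chi (- (a * x)) * q x (x - b))); first by ring.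
by rewrite rootN_sqr mul1r mulrA.
Qed.

Lemma cmod_sub_le (u w : C) : (cmod u - cmod w) ^+ 2 <= cmod (u - w) ^+ 2.
Proof.
have t (x y : C) : cmod x - cmod y <= cmod (x - y).
  by have := le_normcD (x - y) y; rewrite subrK /cmod; lra.
have := t u w; have := t w u.
have -> : cmod (w - u) = cmod (u - w) by rewrite -opprB /cmod normcN.
have := cmod_ge0 (u - w); nra.
Qed.

Lemma cmod_chiM x (z : C) : cmod (chi x * z) = cmod z.
Proof.
rewrite /cmod Normc.normcM -/(cmod (chi x)).
suff -> : cmod (chi x) = 1 by rewrite mul1r.
by apply/eqP; rewrite -sqrp_eq1 ?cmod_chi ?cmod_ge0.
Qed.

Lemma nsq_conj_commutator q (U : 'M[C]_N) : adj U *m U = 1%:M ->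
  nsq (q *m U - U *m q) = nsq (adj U *m q *m U - q).
Proof.
move=> UU; have UU' : U *m adj U = 1%:M by apply: mulmx1C.
transitivity (nsq (adj U *m (q *m U - U *m q))).
  by rewrite [RHS]nsq_ip ip_mull adjK !mulmxA UU' mul1mx -nsq_ip.
by rewrite mulmxBr !mulmxA UU mul1mx.
Qed.

(* Conjugation by the three unitaries permutes the Weyl basis up to phases:
   the clock fixes it, the chirp shears it and the Fourier matrix rotates it. *)
Lemma quantum_expander q :
  nsq (q - (\tr q / N%:R)%:M) <= 100 * (nsq (q *m clockmx - clockmx *m q) +
    nsq (q *m chirpmx - chirpmx *m q) + nsq (q *m fouriermx - fouriermx *m q)).
Proof.
set q0 := q - _.
have comm (U : 'M[C]_N) : q *m U - U *m q = q0 *m U - U *m q0.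
  by rewrite /q0 mulmxBl mulmxBr scalar_mxC opprB addrA subrK.
rewrite !comm.
(* The coefficient at the origin is a multiple of the trace, which [q0] has lost. *)
have q00 : ft q0 0 0 = 0.
  rewrite /ft /dft (_ : \sum_x _ = 0) ?mulr0//.
  under eq_bigr => x _ do rewrite mul0r oppr0 chi0 mul1r addr0 !mxE eqxx mulr1n.
  rewrite sumrB sumr_const card_ord -/(mxtrace q) -[X in _ - X]mulr_natr.
  by rewrite divfK ?subrr// pnatr_eq0.
(* Passing to moduli removes the phases of chirp and Fourier conjugation and only shrinks
   differences. The clock acts by a phase alone, so its term is estimated before taking moduli. *)
pose G (z : 'I_N * 'I_N) := cmod (ft q0 z.1 z.2).
have G0 : G 0 = 0 by rewrite /G /= q00 /cmod Normc.normc0.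
have := torus_gap G0; rewrite ft_parseval.
move=> h; apply: le_trans h _; rewrite ler_pM2l//; apply: lerD; first apply: lerD.
- rewrite nsq_conj_commutator ?clock_isom// -ft_parseval.
  rewrite [leLHS]big_mkcond /=; apply: ler_sum => -[a b] _ /=.
  rewrite ftB ft_clock -{2}[ft q0 a b]mul1r -mulrBl /cmod Normc.normcM exprMn.
  case: ifP => [fa|_]; last by rewrite mulr_ge0 ?sqr_ge0.
  by rewrite /G /= ler_peMl ?sqr_ge0// far_chi.
- rewrite nsq_conj_commutator ?chirp_isom// -ft_parseval.
  apply: ler_sum => -[a b] _ /=; rewrite ftB ft_chirp.
  by apply: le_trans (cmod_sub_le _ _); rewrite cmod_chiM.
(* [ft_fourier] conjugates with the adjoint on the right, whereas [nsq_conj_commutator] has it on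
   the left; hence the adjoint Fourier matrix is used as [U]. *)
- have := nsq_conj_commutator q0 (U := adj fouriermx); rewrite adjK.
  have FF : fouriermx *m adj fouriermx = 1%:M by apply/mulmx1C/fourier_isom.
  move=> /(_ FF) e.
  have -> : nsq (q0 *m fouriermx - fouriermx *m q0) =
            nsq (fouriermx *m q0 *m adj fouriermx - q0).
    rewrite -e -[LHS]nsqN opprB.
    transitivity (nsq ((fouriermx *m q0 - q0 *m fouriermx) *m adj fouriermx)).
      by rewrite [RHS]nsq_ip ip_mulr adjK -mulmxA fourier_isom mulmx1 nsq_ip.
    rewrite mulmxBl -mulmxA -(mulmxA q0) FF mulmx1 mulmxA.
    by rewrite e.
  rewrite -ft_parseval; apply: ler_sum => -[a b] _ /=; rewrite ftB ft_fourier.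
  by apply: le_trans (cmod_sub_le _ _); rewrite cmod_chiM.
Qed.

End Characters.

(** * Transfer of the gap to an embedded matrix algebra *)

Section Amplification.
Variables (R : realType) (m d : nat).
Local Notation N := m.+2.
Local Notation C := R[i].
Variable f : 'M[C]_N -> 'M[C]_d.
Hypothesis fS : star_morph f.
Local Notation e x y := (f (delta_mx x y)).
Implicit Types Y q : 'M[C]_d.

(** These maps turn multiplication by [f U] into multiplication by [U] and jointly preserve the
    norm. They replace a choice of tensor decomposition of the big algebra over the image of [f]. *)
Definition entry_slice Y s t : 'M[C]_N := \matrix_(x, y) (e 0 x *m Y *m e y 0) s t.

Lemma entry_sliceE Y s t x y : entry_slice Y s t x y = (e 0 x *m Y *m e y 0) s t.
Proof. by rewrite mxE. Qed.

Lemma nsq_entry_slice Y : \sum_s \sum_t nsq (entry_slice Y s t) = nsq Y.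
Proof.
transitivity (\sum_x \sum_y nsq (e 0 x *m Y *m e y 0)); last first.
  by under eq_bigr do rewrite nsq_unit_mulr//; rewrite nsq_unit_mull.
under eq_bigr do under eq_bigr do rewrite nsqE.
under [RHS]eq_bigr do under eq_bigr do rewrite nsqE.
rewrite pair_bigA [RHS]pair_bigA /=.
under eq_bigr do rewrite pair_bigA /=; under [RHS]eq_bigr do rewrite pair_bigA /=.
rewrite exchange_big; apply: eq_bigr => -[x y] _ /=; apply: eq_bigr => -[s t] _ /=.
by rewrite mxE.
Qed.

Lemma entry_sliceB Y q s t : entry_slice (Y - q) s t = entry_slice Y s t - entry_slice q s t.
Proof.
apply/matrixP => x y; rewrite [RHS]mxE [X in _ = _ + X]mxE !entry_sliceE.
by rewrite mulmxBr mulmxBl [LHS]mxE [X in _ + X = _]mxE.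
Qed.

Lemma entry_slice_mulr Y U s t : entry_slice (Y *m f U) s t = entry_slice Y s t *m U.
Proof.
apply/matrixP => x y; rewrite entry_sliceE [RHS]mxE -!mulmxA -(smM fS).
have -> : U *m delta_mx y 0 = \sum_z U z y *: delta_mx z 0 :> 'M[C]_N.
  apply/matrixP => i j; rewrite !mxE summxE (bigD1 y)//= [RHS](bigD1 i)//= !mxE !eqxx /=.
  rewrite !big1 ?addr0// => z; rewrite !mxE => /negbTE h; rewrite ?h ?mulr0//.
  by rewrite eq_sym h mulr0.
rewrite sm_sum// !mulmx_sumr summxE; apply: eq_bigr => z _.
by rewrite (smZ fS) -!scalemxAr !mulmxA [LHS]mxE entry_sliceE mulrC.
Qed.

Lemma entry_slice_mull Y U s t : entry_slice (f U *m Y) s t = U *m entry_slice Y s t.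
Proof.
apply/matrixP => x y; rewrite entry_sliceE [RHS]mxE !mulmxA -(smM fS).
have -> : delta_mx 0 x *m U = \sum_z U x z *: delta_mx 0 z :> 'M[C]_N.
  apply/matrixP => i j; rewrite !mxE summxE (bigD1 x)//= [RHS](bigD1 j)//= !mxE !eqxx /=.
  rewrite !andbT !big1 ?addr0 1?mulrC// => z; rewrite !mxE => /negbTE h.
    by rewrite (eq_sym j) h andbF mulr0.
  by rewrite h andbF mul0r.
rewrite sm_sum// !mulmx_suml summxE; apply: eq_bigr => z _.
by rewrite (smZ fS) -!scalemxAl [LHS]mxE entry_sliceE.
Qed.

Definition cond_exp q : 'M[C]_d := N%:R^-1 *: \sum_u \sum_x e u x *m q *m e x u.

Lemma cond_exp_comm q (U : 'M[C]_N) : cond_exp q *m f U = f U *m cond_exp q.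
Proof.
have base a b : (\sum_u \sum_x e u x *m q *m e x u) *m e a b =
                e a b *m (\sum_u \sum_x e u x *m q *m e x u).
  rewrite mulmx_suml mulmx_sumr (bigD1 a)//= [RHS](bigD1 b)//=.
  rewrite [X in _ + X = _]big1 => [|u ua]; last first.
    rewrite mulmx_suml big1// => x _; rewrite -mulmxA sm_unitM//.
    by rewrite (negbTE ua) mulmx0.
  rewrite [X in _ = _ + X]big1 => [|u ub]; last first.
    rewrite mulmx_sumr big1// => x _; rewrite !mulmxA sm_unitM//.
    by rewrite eq_sym (negbTE ub) !mul0mx.
  rewrite !addr0 mulmx_suml mulmx_sumr; apply: eq_bigr => x _.
  by rewrite -mulmxA sm_unitM// eqxx !mulmxA sm_unitM// eqxx.
rewrite /cond_exp -scalemxAl -scalemxAr; congr (_ *: _).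
rewrite (sm_coordE fS U) mulmx_sumr mulmx_suml; apply: eq_bigr => a _.
rewrite mulmx_sumr mulmx_suml; apply: eq_bigr => b _.
by rewrite -scalemxAr -scalemxAl base.
Qed.

Lemma entry_slice_cond_exp q s t :
  entry_slice (cond_exp q) s t = (\tr (entry_slice q s t) / N%:R)%:M.
Proof.
apply/matrixP => x y; rewrite entry_sliceE [RHS]mxE /cond_exp -scalemxAr -scalemxAl mxE mulrC.
have -> : e 0 x *m (\sum_u \sum_z e u z *m q *m e z u) *m e y 0 =
          (x == y)%:R *: \sum_z e 0 z *m q *m e z 0.
  rewrite mulmx_sumr mulmx_suml (bigD1 x)//= [X in _ + X]big1 ?addr0; last first.
    move=> u ux; rewrite mulmx_sumr mulmx_suml big1// => z _.
    by rewrite !mulmxA sm_unitM// eq_sym (negbTE ux) !mul0mx.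
  rewrite mulmx_sumr mulmx_suml scaler_sumr; apply: eq_bigr => z _.
  rewrite !mulmxA sm_unitM// eqxx -!mulmxA sm_unitM//.
  by case: eqP => _; rewrite ?scale1r// scale0r !mulmx0.
rewrite mxE /mxtrace; under [in RHS]eq_bigr do rewrite entry_sliceE.
rewrite -summxE; case: eqP => _; last by rewrite mul0r mul0r mulr0n.
by rewrite mul1r mulr1n.
Qed.

(** On each slice the conditional expectation becomes the normalized trace, so the scalar statement
    applies slice by slice and its constant is unchanged. *)
Lemma amplified_expander q :
  nsq (q - cond_exp q) <= 100 *
    (nsq (q *m f (clockmx R m) - f (clockmx R m) *m q) +
     nsq (q *m f (chirpmx R m) - f (chirpmx R m) *m q) +
     nsq (q *m f (fouriermx R m) - f (fouriermx R m) *m q)).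
Proof.
rewrite -4!(nsq_entry_slice (_ - _)) -2!big_split /= mulr_sumr.
apply: ler_sum => s _; rewrite -2!big_split /= mulr_sumr; apply: ler_sum => t _.
rewrite 4!entry_sliceB 3!entry_slice_mulr 3!entry_slice_mull entry_slice_cond_exp.
exact: quantum_expander.
Qed.

End Amplification.

(** * Tensor legs as star-homomorphisms *)

Section Tensor.
Variable R : realType.
Local Notation C := R[i].

Lemma tensmxDl m n p q (A B : 'M[C]_(m, n)) (D : 'M[C]_(p, q)) :
  (A + B) *t D = A *t D + B *t D.
Proof. by apply/matrixP => i j; rewrite !mxE mulrDl. Qed.

Lemma tensmxDr m n p q (A B : 'M[C]_(m, n)) (D : 'M[C]_(p, q)) :
  D *t (A + B) = D *t A + D *t B.
Proof. by apply/matrixP => i j; rewrite !mxE mulrDr. Qed.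

Lemma tensmxZl m n p q a (A : 'M[C]_(m, n)) (D : 'M[C]_(p, q)) :
  (a *: A) *t D = a *: (A *t D).
Proof. by apply/matrixP => i j; rewrite !mxE mulrA. Qed.

Lemma tensmxZr m n p q a (A : 'M[C]_(m, n)) (D : 'M[C]_(p, q)) :
  D *t (a *: A) = a *: (D *t A).
Proof. by apply/matrixP => i j; rewrite !mxE mulrCA. Qed.

Lemma tensmx11 n p : (1%:M : 'M[C]_n) *t (1%:M : 'M[C]_p) = 1%:M.
Proof.
apply/matrixP => i j.
case: (mxtens_indexP i) => i1 i2; case: (mxtens_indexP j) => j1 j2.
rewrite tensmxE !mxE (can_eq (@mxtens_indexK _ _)) xpair_eqE -natrM mulnb.
by [].
Qed.

Lemma adj_tens n p (A : 'M[C]_n) (B : 'M[C]_p) : adj (A *t B) = adj A *t adj B.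
Proof. by apply/matrixP => i j; rewrite !mxE conjcM. Qed.

Lemma delta_tens n p (a b : 'I_n) (x y : 'I_p) :
  delta_mx (mxtens_index (a, x)) (mxtens_index (b, y)) =
  delta_mx a b *t delta_mx x y :> 'M[C]_(n * p).
Proof.
apply/matrixP => i j.
case: (mxtens_indexP i) => i1 i2; case: (mxtens_indexP j) => j1 j2.
rewrite tensmxE !mxE !(can_eq (@mxtens_indexK _ _)) !xpair_eqE -natrM mulnb.
by rewrite andbACA.
Qed.

Lemma star_tensl n p : star_morph (fun A : 'M[C]_n => A *t (1%:M : 'M[C]_p)).
Proof.
split => *; [exact: tensmxDl|exact: tensmxZl| |exact: tensmx11|].
  by rewrite tensmx_mul mulmx1.
by rewrite adj_tens adj1.
Qed.

Lemma star_tensr n p : star_morph (fun A : 'M[C]_n => (1%:M : 'M[C]_p) *t A).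
Proof.
split => *; [exact: tensmxDr|exact: tensmxZr| |exact: tensmx11|].
  by rewrite tensmx_mul mulmx1.
by rewrite adj_tens adj1.
Qed.

Lemma star_comp n p q (g : 'M[C]_p -> 'M[C]_q) (f : 'M[C]_n -> 'M[C]_p) :
  star_morph g -> star_morph f -> star_morph (fun A => g (f A)).
Proof.
move=> gS fS; split => *.
- by rewrite (smD fS) (smD gS).
- by rewrite (smZ fS) (smZ gS).
- by rewrite (smM fS) (smM gS).
- by rewrite (sm1 fS) (sm1 gS).
- by rewrite (smA fS) (smA gS).
Qed.

End Tensor.

(** * Commutators and two-sided operator bounds *)

Section Commutator.
Variables (R : realType) (d : nat).
Local Notation M := 'M[R[i]]_d.
Implicit Types q X Y : M.

Definition com q X : M := q *m X - X *m q.

Lemma comD q X Y : com q (X + Y) = com q X + com q Y.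
Proof. by rewrite /com mulmxDl mulmxDr opprD addrACA. Qed.

Lemma comZ q a X : com q (a *: X) = a *: com q X.
Proof. by rewrite /com -scalemxAl -scalemxAr scalerBr. Qed.

Lemma comB q X Y : com q (X - Y) = com q X - com q Y.
Proof. by rewrite -scaleN1r comD comZ scaleN1r. Qed.

Lemma comM q X Y : com q (X *m Y) = com q X *m Y + X *m com q Y.
Proof. by rewrite /com mulmxBl mulmxBr !mulmxA addrA subrK. Qed.

Lemma com_sum (I : finType) q (F : I -> M) : com q (\sum_i F i) = \sum_i com q (F i).
Proof. by rewrite /com mulmx_sumr mulmx_suml -sumrB. Qed.

Definition opbound (c : R) X :=
  (forall Y, nrm (X *m Y) <= c * nrm Y) /\ (forall Y, nrm (Y *m X) <= c * nrm Y).

Lemma contr_opbound X : contr X -> opbound 1 X.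
Proof.
move=> cX; split=> Y; rewrite mul1r nrm_le; first exact: cX.
exact: contr_mulr.
Qed.

Lemma opboundD c e X Y : opbound c X -> opbound e Y -> opbound (c + e) (X + Y).
Proof.
move=> [X1 X2] [Y1 Y2]; split=> Z.
  by rewrite mulmxDl mulrDl (le_trans (nrmD_le _ _))// lerD.
by rewrite mulmxDr mulrDl (le_trans (nrmD_le _ _))// lerD.
Qed.

Lemma opbound0 : opbound 0 0.
Proof. by split=> Z; rewrite ?mulmx0 ?mul0mx nrm0 mul0r. Qed.

Lemma opbound_sum (I : finType) (c : I -> R) (F : I -> M) :
  (forall i, opbound (c i) (F i)) -> opbound (\sum_i c i) (\sum_i F i).
Proof.
move=> h; elim/big_rec2 : _ => [|i y Z _ hi]; first exact: opbound0.
exact: opboundD.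
Qed.

Lemma opboundZ c (a : R[i]) X : opbound c X -> opbound (cmod a * c) (a *: X).
Proof.
move=> [X1 X2]; split=> Z; rewrite -?scalemxAl -?scalemxAr nrmZ -mulrA.
  by rewrite ler_wpM2l ?cmod_ge0.
by rewrite ler_wpM2l ?cmod_ge0.
Qed.

Lemma opbound_contr c X : c <= 1 -> opbound c X -> contr X.
Proof.
move=> c1 [X1 _] Y; rewrite -nrm_le (le_trans (X1 Y))//.
by rewrite ler_piMl ?nrm_ge0.
Qed.

Lemma nrm_comM q X Y : contr X -> contr Y ->
  nrm (com q (X *m Y)) <= nrm (com q X) + nrm (com q Y).
Proof.
move=> /contr_opbound[X1 _] /contr_opbound[_ Y2]; rewrite comM.
have := X1 (com q Y); have := Y2 (com q X); rewrite !mul1r => h1 h2.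
by rewrite (le_trans (nrmD_le _ _))// lerD.
Qed.

Lemma nrm_mul_contr (P Q X : M) : contr P -> contr Q -> nrm (P *m X *m Q) <= nrm X.
Proof.
move=> /contr_opbound[h1 _] /contr_opbound[_ h2].
by have := h1 X; have := h2 (P *m X); rewrite !mul1r; apply: le_trans.
Qed.

End Commutator.

Section Blocks.
Variables (R : realType) (n : nat) (Z T F : 'M[R[i]]_n).
Implicit Types a b : 'I_4.

(* Level 0 is linked to every other level by identities, which forces an operator
   commuting with the couplings to act in the same way on all levels; the three
   remaining links then make it commute with [Z], [T] and [F]. *)
Definition block_of a b : 'M[R[i]]_n :=
  match val a, val b with
  | 0%N, 0%N => 0
  | 0%N, _ => 1%:M
  | _, 0%N => 1%:M
  | 1%N, 2%N => Z
  | 2%N, 1%N => adj Z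
  | 1%N, 3%N => T
  | 3%N, 1%N => adj T
  | 2%N, 3%N => F
  | 3%N, 2%N => adj F
  | _, _ => 0
  end.

Lemma block_of_adj a b : adj (block_of a b) = block_of b a.
Proof.
by case: a b => [[|[|[|[|//]]]] ?] [[|[|[|[|//]]]] ?];
  rewrite /block_of /=; first [exact: adj0|exact: adj1|exact: adjK|reflexivity].
Qed.

Lemma block_of_ind (P : 'M[R[i]]_n -> Prop) : P 0 -> P 1%:M ->
  P Z -> P (adj Z) -> P T -> P (adj T) -> P F -> P (adj F) ->
  forall a b, P (block_of a b).
Proof. by move=> ? ? ? ? ? ? ? ? [[|[|[|[|//]]]] ?] [[|[|[|[|//]]]] ?]. Qed.

End Blocks.

(** 17 bounds the coupling and 8e each projection commutator: 2 * 17 * 8 + 1 = 273, rounded up to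
    300. *)
Lemma corner_arith (R : realType) (x y u v w z k l n e : R) : 0 <= e ->
  x <= 1 * u -> u <= v + w -> v <= 17 * k -> w <= 1 * n -> y <= 1 * z -> z <= 17 * l ->
  k <= 8 * e -> l <= 8 * e -> n <= e -> x + y <= 300 * e.
Proof. lra. Qed.

Lemma sandwich_arith (R : realType) (x y z k l e : R) : x <= y + l -> y <= k + z -> k <= 600 * e ->
  l <= 600 * e -> z <= 300 * e -> x <= 1500 * e.
Proof. lra. Qed.

Lemma expander_arith (R : realType) (x y z u : R) : x <= u -> y <= u -> z <= u ->
  0 <= u -> 100 * (x + y + z) <= 18 ^+ 2 * u.
Proof. lra. Qed.

Lemma quarter_arith (R : realType) (x y : R) : x <= 16 * y -> 4^-1 * x <= 4 * y.
Proof. lra. Qed.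

Lemma average_arith (R : realType) (x y z e : R) : 0 <= e -> x <= 4 * (600 * e) ->
  y <= 4 * z -> z <= 18 * (60 * 100 * e) -> x + y <= 10 ^+ 6 * e.
Proof. lra. Qed.

Lemma half_arith (R : realType) (x a b u v : R) : x <= a + b -> a = 32 * u ->
  b = 32 * v -> 2^-1 * x <= 16 * (u + v).
Proof. by move=> h a1 b1; rewrite a1 b1 in h; lra. Qed.

(** The constant is 10^12 * 16^2 * 2, which is below 10^15. *)
Lemma gap_arith (R : realType) (x u v : R) : 0 <= u -> 0 <= v -> 0 <= x ->
  x <= 10 ^+ 6 * (16 * (u + v)) -> x ^+ 2 <= 10 ^+ 15 * (u ^+ 2 + v ^+ 2).
Proof.
move=> u0 v0 x0 hx.
have hx2 : x ^+ 2 <= (10 ^+ 6 * (16 * (u + v))) ^+ 2.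
  by rewrite ler_pXn2r ?nnegrE// mulr_ge0// mulr_ge0// addr_ge0.
apply: le_trans hx2 _.
have w : (u + v) ^+ 2 <= 2 * (u ^+ 2 + v ^+ 2) by have := sqr_ge0 (u - v); nra.
rewrite !exprMn; have : 0 <= u ^+ 2 + v ^+ 2 by rewrite addr_ge0 ?sqr_ge0.
by move: ((u + v) ^+ 2) (u ^+ 2 + v ^+ 2) w => y z; lra.
Qed.

(** * Single generators with a spectral gap *)

Section Gap.
Variables (R : realType) (m d : nat).
Local Notation N := m.+2.
Local Notation C := R[i].
Variables (iota : 'M[C]_(4 * N) -> 'M[C]_d) (s : 'M[C]_d).
Hypothesis iS : star_morph iota.
Implicit Types (a b c : 'I_4) (q : 'M[C]_d).

Definition legl (w : 'M[C]_4) : 'M[C]_d := iota (w *t 1%:M).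
Definition legr (w : 'M[C]_N) : 'M[C]_d := iota (1%:M *t w).
Local Notation E a b := (legl (delta_mx a b)).

Lemma leglS : star_morph legl.
Proof. exact: star_comp iS (star_tensl _ _ _). Qed.

Lemma legrS : star_morph legr.
Proof. exact: star_comp iS (star_tensr _ _ _). Qed.

Lemma leg_mul w v : legl w *m legr v = iota (w *t v).
Proof. by rewrite -(smM iS) tensmx_mul mulmx1 mul1mx. Qed.

Lemma leg_comm w v : legr v *m legl w = legl w *m legr v.
Proof. by rewrite leg_mul -(smM iS) tensmx_mul mulmx1 mul1mx. Qed.

Definition block := block_of (clockmx R m) (chirpmx R m) (fouriermx R m).

Lemma block_adj a b : adj (block a b) = block b a.
Proof. exact: block_of_adj. Qed.

(** Distinct integer eigenvalues: between different levels a commutator with this matrix multiplies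
    the block of [q] by a number of modulus at least 1. *)
Definition levelmx : 'M[C]_(4 * N) := diag_mx (\row_(a < 4) (a%:R : C)) *t 1%:M.
Definition couplingmx : 'M[C]_(4 * N) := \sum_a \sum_b delta_mx a b *t block a b.

(* [s] lives on level 0, whose diagonal block is otherwise empty. *)
Definition coupling : 'M[C]_d := iota couplingmx + s.
Definition rawgen : 'M[C]_d := iota levelmx + 'i%C *: coupling.
(** Levels contribute at most 0 + 1 + 2 + 3 = 6 to the operator norm and the coupling at most 16 + 1
    (sixteen blocks and [s]); 32 exceeds the total 23. *)
Definition gen : 'M[C]_d := (32^-1)%:C%C *: rawgen.

Hypothesis s_adj : adj s = s.
Hypothesis s_contr : contr s.
Hypothesis s_corner : E 0 0 *m s *m E 0 0 = s.

Lemma star_isom_contr k (f : 'M[C]_k -> 'M[C]_d) (U : 'M[C]_k) :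
  star_morph f -> adj U *m U = 1%:M -> contr (f U).
Proof. by move=> fS UU; apply: isom_contr; rewrite -(smA fS) -(smM fS) UU (sm1 fS). Qed.

Lemma star_unit_contr k (f : 'M[C]_k -> 'M[C]_d) (a b : 'I_k) :
  star_morph f -> contr (f (delta_mx a b)).
Proof.
move=> fS Y; rewrite -[leRHS](nsq_unit_mull fS _ a) (bigD1 b)//= lerDl sumr_ge0// => c _.
exact: nsq_ge0.
Qed.

Lemma block_contr a b : contr (legr (block a b)).
Proof.
have c0 : contr (0 : 'M[C]_d) by move=> Y; rewrite mul0mx nsq0 nsq_ge0.
have c1 : contr (legr 1%:M).
  by apply: star_isom_contr; [exact: legrS|rewrite adj1 mulmx1].
have cU (U : 'M[C]_N) : adj U *m U = 1%:M -> contr (legr U) /\ contr (legr (adj U)).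
  move=> UU; split; apply: star_isom_contr => //; try exact: legrS.
  by rewrite adjK; apply: mulmx1C.
have [z z'] := cU _ (clock_isom R m); have [t t'] := cU _ (chirp_isom R m).
have [f f'] := cU _ (fourier_isom R m).
apply: (block_of_ind (P := fun U => contr (legr U)));
  [|exact: c1|exact: z|exact: z'|exact: t|exact: t'|exact: f|exact: f'].
by rewrite (sm0 legrS).
Qed.

Lemma coupling_bound : opbound 17 coupling.
Proof.
have -> : 17 = \sum_(a < 4) \sum_(b < 4) 1 + 1 :> R.
  by rewrite !sumr_const !card_ord -mulrnA natr1.
apply: opboundD; last exact: contr_opbound.
rewrite /couplingmx sm_sum//; apply: opbound_sum => a.
rewrite sm_sum//; apply: opbound_sum => b; apply: contr_opbound.
by rewrite -leg_mul; apply: contr_mul (block_contr _ _); apply: star_unit_contr leglS.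
Qed.

Lemma levelE : iota levelmx = \sum_(a < 4) (a%:R : C) *: E a a.
Proof.
rewrite /levelmx -/(legl _) diag_mx_sum_delta sm_sum; last exact: leglS.
by apply: eq_bigr => a _; rewrite (smZ leglS) mxE.
Qed.

Lemma level_bound : opbound 6 (iota levelmx).
Proof.
rewrite levelE.
have -> : 6 = \sum_(a < 4) cmod (a%:R : C) * 1 :> R.
  have e (k : nat) : cmod (k%:R : C) = k%:R.
    have -> : (k%:R : C) = (k%:R : R)%:C%C by rewrite rmorph_nat.
    by rewrite /cmod /= expr0n addr0 sqrtr_sqr ger0_norm.
  under eq_bigr do rewrite e mulr1.
  by rewrite -natr_sum !big_ord_recl big_ord0.
apply: opbound_sum => a; apply: opboundZ; apply: contr_opbound.
by apply: star_unit_contr leglS.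
Qed.

Lemma gen_contr : contr gen.
Proof.
have h : opbound 23 rawgen.
  have -> : 23 = 6 + 1 * 17 :> R by ring.
  apply: opboundD level_bound _; have := opboundZ 'i%C coupling_bound.
  by rewrite {1}/cmod /= expr0n expr1n add0r sqrtr1.
apply: (@opbound_contr _ _ (cmod ((32^-1)%:C%C : C) * 23)); last exact: opboundZ.
by rewrite /cmod /= expr0n addr0 sqrtr_sqr ger0_norm; lra.
Qed.

Lemma coupling_adj : adj coupling = coupling.
Proof.
rewrite /coupling adjD s_adj -(smA iS); congr (iota _ + _).
rewrite /couplingmx adj_sum exchange_big; apply: eq_bigr => a _ /=.
rewrite adj_sum; apply: eq_bigr => b _; by rewrite adj_tens adj_delta block_adj.
Qed.

Lemma level_adj : adj (iota levelmx) = iota levelmx.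
Proof.
rewrite levelE adj_sum; apply: eq_bigr => a _.
by rewrite adjZ conjc_nat sm_unitA; last exact: leglS.
Qed.

Lemma rawgen_adj : adj rawgen = iota levelmx - 'i%C *: coupling.
Proof.
rewrite /rawgen adjD adjZ coupling_adj level_adj -scaleNr; congr (_ + _ *: _).
by rewrite /conjc /=; apply/eqP; rewrite eq_complex /= oppr0 !eqxx.
Qed.


Lemma cmodR (x : R) : cmod (x%:C%C) = `|x|.
Proof. by rewrite /cmod /= expr0n addr0 sqrtr_sqr. Qed.

Section Commutators.
Variables (q : 'M[C]_d) (e : R).
Hypothesis e0 : 0 <= e.
Hypothesis q_level : nrm (com q (iota levelmx)) <= e.
Hypothesis q_coupling : nrm (com q coupling) <= e.

Lemma unitM a b c c' : E a b *m E c c' = if b == c then E a c' else 0.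
Proof. exact: (sm_unitM leglS). Qed.

Lemma unit_contr a b : contr (E a b).
Proof. exact: star_unit_contr leglS. Qed.

Lemma nrm_off_diag a b : a != b -> nrm (E a a *m q *m E b b) <= e.
Proof.
move=> ab; have lE : iota levelmx *m E b b = (b%:R : C) *: E b b.
  rewrite levelE mulmx_suml (bigD1 b)//= big1 => [|c cb].
    by rewrite addr0 -scalemxAl unitM eqxx.
  by rewrite -scalemxAl unitM (negbTE cb) scaler0.
have El : E a a *m iota levelmx = (a%:R : C) *: E a a.
  rewrite levelE mulmx_sumr (bigD1 a)//= big1 => [|c ca].
    by rewrite addr0 -scalemxAr unitM eqxx.
  by rewrite -scalemxAr unitM eq_sym (negbTE ca) scaler0.
have h : E a a *m com q (iota levelmx) *m E b b =
         ((b%:R : R) - a%:R)%:C%C *: (E a a *m q *m E b b).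
  rewrite /com mulmxBr mulmxBl !mulmxA El -(mulmxA (E a a *m q)) lE.
  rewrite -scalemxAr -!scalemxAl -scalerBl; congr (_ *: _).
  by rewrite rmorphB !rmorph_nat.
have := nrm_mul_contr (com q (iota levelmx)) (unit_contr a a) (unit_contr b b).
rewrite h nrmZ cmodR => h1; apply: le_trans q_level; apply: le_trans h1.
rewrite ler_peMl ?nrm_ge0//; move: ab; rewrite -val_eqE neq_ltn => /orP[] ab.
  have h' : (a.+1%:R : R) <= b%:R by rewrite ler_nat.
  by rewrite -natr1 in h'; rewrite ger0_norm; lra.
have h' : (b.+1%:R : R) <= a%:R by rewrite ler_nat.
by rewrite -natr1 in h'; rewrite distrC ger0_norm; lra.
Qed.

Lemma nrm_com_proj a : nrm (com q (E a a)) <= 8 * e.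
Proof.
have -> : com q (E a a) = \sum_b (E b b *m q *m E a a - E a a *m q *m E b b).
  rewrite sumrB -mulmx_sumr -!mulmx_suml (sm_unit1 leglS) mul1mx.
  by rewrite mulmx1.
apply: le_trans (nrm_sum_le _ _ _) _.
apply: le_trans (_ : \sum_(b < 4) 2 * e <= _); last first.
  by rewrite sumr_const card_ord -mulr_natl; lra.
apply: ler_sum => b _; have [->|ba] := eqVneq b a.
  by rewrite subrr nrm0 mulr_ge0.
apply: le_trans (nrmB_le _ _) _.
have := nrm_off_diag ba; rewrite eq_sym in ba; have := nrm_off_diag ba; lra.
Qed.

Lemma coupling_corner a b : (a != 0) || (b != 0) ->
  E a a *m coupling *m E b b = E a b *m legr (block a b).
Proof.
move=> ab; rewrite /coupling mulmxDr mulmxDl.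
have -> : E a a *m s *m E b b = 0.
  rewrite -s_corner !mulmxA unitM.
  case: eqP ab => [-> /= b0|_ _]; last by rewrite !mul0mx.
  by rewrite -!mulmxA unitM eq_sym (negbTE b0) !mulmx0.
rewrite addr0 /couplingmx sm_sum// mulmx_sumr mulmx_suml (bigD1 a)//=.
rewrite [X in _ + X]big1 => [|c ca]; last first.
  rewrite sm_sum// mulmx_sumr mulmx_suml big1// => c' _.
  by rewrite -leg_mul !mulmxA unitM eq_sym (negbTE ca) !mul0mx.
rewrite addr0 sm_sum// mulmx_sumr mulmx_suml (bigD1 b)//=.
rewrite [X in _ + X]big1 => [|c cb]; last first.
  by rewrite -leg_mul -!mulmxA leg_comm (mulmxA (E a c)) unitM (negbTE cb) mul0mx mulmx0.
by rewrite addr0 -leg_mul !mulmxA unitM eqxx -mulmxA leg_comm mulmxA unitM eqxx.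
Qed.

Lemma nrm_com_block a b : (a != 0) || (b != 0) ->
  nrm (com q (E a b *m legr (block a b))) <= 300 * e.
Proof.
move=> /coupling_corner <-; rewrite !comM.
have pa := nrm_com_proj a; have pb := nrm_com_proj b.
have [_ ca] := contr_opbound (unit_contr b b).
have [cb _] := contr_opbound (unit_contr a a).
have [c1 c2] := coupling_bound.
have t1 := ca (com q (E a a) *m coupling + E a a *m com q coupling).
have t2 := nrmD_le (com q (E a a) *m coupling) (E a a *m com q coupling).
have t3 := c2 (com q (E a a)); have t4 := cb (com q coupling).
have t5 := cb (coupling *m com q (E b b)); have t6 := c1 (com q (E b b)).
rewrite mulmxA in t5; apply: le_trans (nrmD_le _ _) _.
exact: corner_arith e0 t1 t2 t3 t4 t5 t6 pa pb q_coupling.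
Qed.

Lemma nrm_com_unit a b : nrm (com q (E a b)) <= 600 * e.
Proof.
have hub c : c != 0 -> nrm (com q (E 0 c)) <= 300 * e /\ nrm (com q (E c 0)) <= 300 * e.
  move=> c0.
  have [b1 b2] : block 0 c = 1%:M /\ block c 0 = 1%:M.
    by move: c0; rewrite /block /block_of; case: c => -[|[|[|[|//]]]].
  have := @nrm_com_block 0 c; have := @nrm_com_block c 0.
  by rewrite c0 orbT b1 b2 (sm1 legrS) !mulmx1 => h1 h2; split; [apply: h2|apply: h1].
have [->|a0] := eqVneq a 0; have [->|b0] := eqVneq b 0.
(* The corner at level 0 contains [s] and is not controlled directly, so its projection is reached
   through level 1. *)
- have o1 : (Ordinal (isT : (1 < 4)%N)) != 0 by [].
  have -> : E 0 0 = E 0 (Ordinal (isT : (1 < 4)%N)) *m E (Ordinal (isT : (1 < 4)%N)) 0.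
    by rewrite unitM eqxx.
  have [h1 h2] := hub _ o1.
  apply: le_trans (nrm_comM _ (unit_contr _ _) (unit_contr _ _)) _.
  have -> : 600 * e = 300 * e + 300 * e by ring.
  exact: (lerD h1 h2).
- by have [h1 _] := hub _ b0; apply: le_trans h1 _; move: e0; lra.
- by have [_ h1] := hub _ a0; apply: le_trans h1 _; move: e0; lra.
- have -> : E a b = E a 0 *m E 0 b by rewrite unitM eqxx.
  have [_ h1] := hub _ a0; have [h2 _] := hub _ b0.
  apply: le_trans (nrm_comM _ (unit_contr _ _) (unit_contr _ _)) _.
  have -> : 600 * e = 300 * e + 300 * e by ring.
  exact: (lerD h1 h2).
Qed.

Lemma nrm_com_legr a b : (a != 0) || (b != 0) ->
  nrm (com q (legr (block a b))) <= 60 * 100 * e.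
Proof.
move=> ab; set U := block a b.
(* The single block from level [a] to level [b] is transported to every diagonal position; each of
   the four terms costs 600 + 300 + 600. *)
have UE : legr U = \sum_c E c a *m (E a b *m legr U) *m E b c.
  transitivity (\sum_c E c c *m legr U).
    by rewrite -mulmx_suml (sm_unit1 leglS) mul1mx.
  apply: eq_bigr => c _; rewrite !mulmxA unitM eqxx -mulmxA leg_comm mulmxA.
  by rewrite unitM eqxx.
rewrite UE com_sum; apply: le_trans (nrm_sum_le _ _ _) _.
apply: le_trans (_ : \sum_(c < 4) 1500 * e <= _); last first.
  by rewrite sumr_const card_ord -mulr_natl; lra.
apply: ler_sum => c _.
have cU : contr (E a b *m legr U) by apply: contr_mul (block_contr a b); apply: unit_contr.
have t1 := nrm_comM q (contr_mul (unit_contr c a) cU) (unit_contr b c).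
have t2 := nrm_comM q (unit_contr c a) cU.
have t3 := nrm_com_unit c a; have t4 := nrm_com_unit b c.
have t5 := nrm_com_block ab; rewrite -/U in t5.
exact: sandwich_arith t1 t2 t3 t4 t5.
Qed.

(** Both tensor factors are averaged out in turn; [m := 2] selects size 4, as [cond_exp] is indexed
    by the size minus two. *)
Definition leg_average : 'M[C]_d := cond_exp (m := 2) legl (cond_exp legr q).

Lemma leg_average_comm w : leg_average *m iota w = iota w *m leg_average.
Proof.
have cl v : leg_average *m legl v = legl v *m leg_average.
  exact: (cond_exp_comm leglS).
have cr v : leg_average *m legr v = legr v *m leg_average.
  rewrite /leg_average /cond_exp -scalemxAl -scalemxAr; congr (_ *: _).
  rewrite mulmx_suml mulmx_sumr; apply: eq_bigr => a _.
  rewrite mulmx_suml mulmx_sumr; apply: eq_bigr => b _.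
  rewrite -mulmxA -leg_comm mulmxA -(mulmxA (E a b)) (cond_exp_comm legrS).
  by rewrite !mulmxA leg_comm.
rewrite (sm_coordE iS w) mulmx_sumr mulmx_suml; apply: eq_bigr => i _.
rewrite mulmx_sumr mulmx_suml; apply: eq_bigr => j _.
rewrite -scalemxAr -scalemxAl; congr (_ *: _).
case: (mxtens_indexP i) => a x; case: (mxtens_indexP j) => b y.
by rewrite delta_tens -leg_mul mulmxA cl -!mulmxA cr.
Qed.

Lemma nrm_leg_average : nrm (q - leg_average) <= 10 ^+ 6 * e.
Proof.
pose q1 := cond_exp legr q.
(* Three commutators enter the expander bound with factor 100, and 300 <= 18^2. *)
have t1 : nrm (q - q1) <= 18 * ((60 * 100) * e).
  rewrite -(ler_pXn2r (n := 2)) ?nnegrE ?nrm_ge0// ?mulr_ge0// nrm_sqr.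
  apply: le_trans (amplified_expander legrS q) _.
  have sq (X : 'M[C]_d) : nrm X <= (60 * 100) * e -> nsq X <= ((60 * 100) * e) ^+ 2.
    by rewrite -nrm_sqr => h; rewrite ler_pXn2r ?nnegrE ?nrm_ge0// mulr_ge0.
  pose o1 : 'I_4 := Ordinal (isT : (1 < 4)%N).
  pose o2 : 'I_4 := Ordinal (isT : (2 < 4)%N).
  pose o3 : 'I_4 := Ordinal (isT : (3 < 4)%N).
  have h1 := sq _ (@nrm_com_legr o1 o2 isT).
  have h2 := sq _ (@nrm_com_legr o1 o3 isT).
  have h3 := sq _ (@nrm_com_legr o2 o3 isT).
  rewrite [(18 * _) ^+ 2]exprMn.
  exact: (expander_arith h1 h2 h3 (sqr_ge0 _)).
have cexpB X Y : cond_exp (m := 2) legl (X - Y) = cond_exp (m := 2) legl X - cond_exp (m := 2) legl Y.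
  rewrite /cond_exp -scalerBr -sumrB; congr (_ *: _); apply: eq_bigr => a _.
  by rewrite -sumrB; apply: eq_bigr => b _; rewrite mulmxBr mulmxBl.
have c4 : cmod ((4%:R : C)^-1) = 4^-1.
  have -> : (4%:R : C)^-1 = (4^-1)%:C%C by rewrite fmorphV rmorph_nat.
  by rewrite cmodR ger0_norm// invr_ge0.
have sum16 (c : R) : \sum_(a < 4) \sum_(b < 4) c = 16 * c.
  by rewrite !sumr_const !card_ord -mulrnA mulr_natl.
have t2 X : nrm (cond_exp (m := 2) legl X) <= 4 * nrm X.
  rewrite /cond_exp nrmZ c4.
  apply: quarter_arith.
  rewrite -sum16; apply: le_trans (nrm_sum_le _ _ _) _; apply: ler_sum => a _.
  apply: le_trans (nrm_sum_le _ _ _) _; apply: ler_sum => b _.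
  by apply: nrm_mul_contr; apply: unit_contr.
(* On the four levels every matrix unit almost commutes with [q], so the average is compared with
   [q] term by term. *)
have t3 : nrm (q - cond_exp (m := 2) legl q) <= 4 * (600 * e).
  have -> : q - cond_exp (m := 2) legl q =
      (4%:R : C)^-1 *: \sum_a \sum_b com q (E a b) *m E b a.
    have -> : \sum_a \sum_b com q (E a b) *m E b a =
              4%:R *: q - \sum_a \sum_b E a b *m q *m E b a.
      have -> : 4%:R *: q = \sum_a \sum_b q *m (E a b *m E b a).
        under eq_bigr do under eq_bigr do rewrite unitM eqxx.
        under eq_bigr do rewrite sumr_const card_ord.
        by rewrite sumrMnl -mulmx_sumr (sm_unit1 leglS) mulmx1 scaler_nat.
      rewrite -sumrB; apply: eq_bigr => a _; rewrite -sumrB; apply: eq_bigr => b _.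
      by rewrite mulmxBl mulmxA.
    have n4 : (4%:R : C) != 0 by rewrite pnatr_eq0.
    by rewrite scalerBr scalerA (mulVf n4) scale1r.
  rewrite nrmZ c4.
  apply: quarter_arith.
  rewrite -sum16; apply: le_trans (nrm_sum_le _ _ _) _; apply: ler_sum => a _.
  apply: le_trans (nrm_sum_le _ _ _) _; apply: ler_sum => b _.
  have [_ h] := contr_opbound (unit_contr b a).
  by have := h (com q (E a b)); rewrite mul1r => /le_trans -> //; apply: nrm_com_unit.
have -> : q - leg_average = (q - cond_exp (m := 2) legl q) + cond_exp (m := 2) legl (q - q1).
  by rewrite cexpB addrA subrK.
apply: le_trans (nrmD_le _ _) _; exact: average_arith e0 t3 (t2 _) t1.
Qed.

End Commutators.

Theorem gen_gap q : exists2 y, (forall w, y *m iota w = iota w *m y) &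
  nsq (q - y) <= 10 ^+ 15 *
    (nsq (q *m gen - gen *m q) + nsq (q *m adj gen - adj gen *m q)).
Proof.
exists (leg_average q); first exact: leg_average_comm.
rewrite -/(com q gen) -/(com q (adj gen)).
(* 16 = 32 / 2: undoing the normalization gives 32, and taking the real or imaginary part halves
   it. *)
pose e := 16 * (nrm (com q gen) + nrm (com q (adj gen))).
have n1 := nrm_ge0 (com q gen); have n2 := nrm_ge0 (com q (adj gen)).
have rg : rawgen = 32%:C%C *: gen.
  by rewrite /gen scalerA -rmorphM /= mulfV ?scale1r.
have rga : adj rawgen = 32%:C%C *: adj gen by rewrite rg adjZ conjc_real.
have two (X : 'M[C]_d) : X + X = (2 : R)%:C%C *: X.
  by rewrite -{1 2}[X]scale1r -scalerDl rmorph_nat mulr2n.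
have lE : iota levelmx = (2^-1)%:C%C *: (rawgen + adj rawgen).
  rewrite rawgen_adj /rawgen addrACA subrr addr0 two scalerA -rmorphM /=.
  by rewrite mulVf ?scale1r ?pnatr_eq0.
have cE : coupling = (- ('i * (2^-1)%:C))%C *: (rawgen - adj rawgen).
  rewrite rawgen_adj /rawgen opprB addrC subrKA two !scalerA.
  rewrite -[LHS]scale1r; congr (_ *: _); apply/eqP.
  by rewrite eq_complex /=; apply/andP; split; apply/eqP; field.
have b32 : cmod (32%:C%C : C) = 32 by rewrite cmodR ger0_norm.
have e0 : 0 <= e := mulr_ge0 (ler0n _ 16) (addr_ge0 n1 n2).
have r1 : nrm (com q rawgen) = 32 * nrm (com q gen) by rewrite rg comZ nrmZ b32.
have r2 : nrm (com q (adj rawgen)) = 32 * nrm (com q (adj gen)).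
  by rewrite rga comZ nrmZ b32.
have h1 : nrm (com q (iota levelmx)) <= e.
  rewrite lE comZ nrmZ comD cmodR ger0_norm ?invr_ge0//.
  exact: half_arith (nrmD_le _ _) r1 r2.
have h2 : nrm (com q coupling) <= e.
  rewrite cE comZ nrmZ comB.
  have -> : cmod (- ('i * (2^-1)%:C))%C = 2^-1 :> R.
    apply/eqP; rewrite -(eqrXn2 (n := 2)) ?cmod_ge0 ?invr_ge0// cmod_sqr /=.
    by apply/eqP; field.
  exact: half_arith (nrmB_le _ _) r1 r2.
have := nrm_leg_average e0 h1 h2; rewrite -[nsq (q - _)]nrm_sqr -!nrm_sqr /e.
have := nrm_ge0 (q - leg_average q).
by move=> x0 /(gap_arith n1 n2 x0).
Qed.

End Gap.

(** * Pauli matrices of n spins *)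

Section Spins.
Variables (R : realType) (n : nat).
Local Notation C := R[i].
Local Notation J := {ffun 'I_n -> bool}.
Local Notation r := #|J|.
Implicit Types (i j : 'I_n) (s t : 'I_r).

Definition bit i s : bool := (enum_val s : J) i.
Definition flip i s : 'I_r := enum_rank ([ffun j => bit j s (+) (j == i)] : J).

Lemma bit_flip i j s : bit j (flip i s) = bit j s (+) (j == i).
Proof. by rewrite /bit /flip enum_rankK ffunE. Qed.

Lemma bit_inj s t : (forall i, bit i s = bit i t) -> s = t.
Proof. by move=> h; apply: enum_val_inj; apply/ffunP => i; apply: h. Qed.

Lemma flipK i : involutive (flip i).
Proof. by move=> s; apply: bit_inj => j; rewrite !bit_flip -addbA addbb addbF. Qed.

Definition spinx i : 'M[C]_r := \matrix_(s, t) (t == flip i s)%:R.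
Definition spinz i : 'M[C]_r := diag_mx (\row_s (-1) ^+ bit i s).

Lemma spinx_mul i X s t : (spinx i *m X) s t = X (flip i s) t.
Proof.
rewrite mxE (bigD1 (flip i s))//= mxE eqxx mul1r big1 ?addr0// => u /negbTE us.
by rewrite mxE us mul0r.
Qed.

Lemma spinx_adj i : adj (spinx i) = spinx i.
Proof.
apply/matrixP => s t; rewrite adjE !mxE conjc_nat.
by rewrite eq_sym (inv_eq (flipK i)).
Qed.

Lemma spinz_adj i : adj (spinz i) = spinz i.
Proof.
apply/matrixP => s t; rewrite adjE !mxE eq_sym.
have [->|_] := eqVneq s t; last by rewrite !mulr0n conjc0.
by rewrite !mulr1n; case: (bit i t); rewrite ?expr1 ?expr0 ?conjc1 // rmorphN1.
Qed.

Lemma spinx_sqr i : spinx i *m spinx i = 1%:M.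
Proof. by apply/matrixP => s t; rewrite spinx_mul !mxE flipK eq_sym. Qed.

Lemma spinz_sqr i : spinz i *m spinz i = 1%:M.
Proof.
apply/matrixP => s t; rewrite mul_diag_mx !mxE.
by case: eqP => [->|_]; rewrite ?mulr0n ?mulr0// mulr1n -expr2 sqrr_sign.
Qed.

Lemma spin_mul i j : spinx i *m spinz j = (-1) ^+ (i == j) *: (spinz j *m spinx i).
Proof.
apply/matrixP => s t; rewrite spinx_mul mul_diag_mx !mxE bit_flip (eq_sym t) (eq_sym j).
have [_|_] := eqVneq (flip i s) t; last by rewrite mulr0n !mulr0.
by rewrite mulr1n mulr1 signr_addb mulrC.
Qed.

End Spins.

Lemma delta_mul_delta (F : comNzRingType) n (w : 'M[F]_n) (a c : 'I_n) :
  delta_mx c a *m w *m delta_mx a c = w a a *: delta_mx c c.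
Proof.
rewrite -(mul_delta_mx (0 : 'I_1) c a) -(mul_delta_mx (0 : 'I_1) a c) !mulmxA.
rewrite -(mulmxA _ (delta_mx 0 a) w) -rowE -(mulmxA _ (row a w)) -colE.
by rewrite [col a _]mx11_scalar mul_mx_scalar -scalemxAl mul_delta_mx !mxE.
Qed.

(** * The spin element and the slices of a generator *)

Section SpinTerm.
Variables (R : realType) (m d r : nat).
Local Notation N := m.+2.
Local Notation k := (4 * N)%N.
Local Notation C := R[i].
Variables (iota : 'M[C]_k -> 'M[C]_d) (jota : 'M[C]_r -> 'M[C]_d) (tau : 'I_N -> 'M[C]_r).
Hypothesis iS : star_morph iota.
Hypothesis jS : star_morph jota.
Hypothesis ij_comm : forall w v, jota v *m iota w = iota w *m jota v.
Hypothesis tau_adj : forall i, adj (tau i) = tau i.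
Hypothesis tau_sqr : forall i, tau i *m tau i = 1%:M.

(** Sites sit on level 0, where [levelmx] and [couplingmx] have zero diagonal entries, so that a
    diagonal slice sees the spin alone. *)
Definition site (i : 'I_N) : 'I_k := mxtens_index (0 : 'I_4, i).

Lemma site_eq i j : (site i == site j) = (i == j).
Proof. by rewrite (can_eq (@mxtens_indexK _ _)) xpair_eqE eqxx. Qed.

Local Notation e i := (iota (delta_mx (site i) (site i))).

Definition spin_term : 'M[C]_d := \sum_i e i *m jota (tau i).

Lemma site_mul i j : e i *m e j = if i == j then e i else 0.
Proof. by rewrite (sm_unitM iS) site_eq; case: eqP => [->|]. Qed.

Lemma spin_term_adj : adj spin_term = spin_term.
Proof.
rewrite /spin_term adj_sum; apply: eq_bigr => i _.
by rewrite adj_mul -(smA jS) tau_adj sm_unitA// ij_comm.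
Qed.

Lemma spin_term_sqr : spin_term *m spin_term = \sum_i e i.
Proof.
rewrite {1}/spin_term mulmx_suml; apply: eq_bigr => i _.
rewrite /spin_term mulmx_sumr (bigD1 i)//= big1 => [|j ji].
  rewrite addr0 -mulmxA (mulmxA (jota _)) ij_comm -mulmxA -(smM jS) tau_sqr (sm1 jS).
  by rewrite mulmx1 site_mul eqxx.
by rewrite -mulmxA (mulmxA (jota _)) ij_comm !mulmxA site_mul eq_sym (negbTE ji) !mul0mx.
Qed.

(** The element s is self-adjoint with s^3 = s, so its eigenvalues are among -1, 0, 1. Concretely,
    sY and s^2 Y have equal norm, and pairing s^2 Y with Y bounds it by the norm of Y. *)
Lemma spin_term_contr : contr spin_term.
Proof.
have s3 : spin_term *m spin_term *m spin_term = spin_term.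
  rewrite spin_term_sqr mulmx_suml; apply: eq_bigr => i _.
  rewrite mulmx_sumr (bigD1 i)//= big1 => [|j ji].
    by rewrite addr0 mulmxA site_mul eqxx.
  by rewrite mulmxA site_mul eq_sym (negbTE ji) mul0mx.
move=> Y; pose Z := spin_term *m Y.
have h1 : ip (spin_term *m Z) Y = nsq Z by rewrite ip_mull spin_term_adj -nsq_ip.
have h2 : nsq (spin_term *m Z) = nsq Z.
  by rewrite nsq_ip ip_mull spin_term_adj /Z !mulmxA s3 -nsq_ip.
by have := ip_le_nsq (spin_term *m Z) Y; rewrite h1 h2 -/Z; lra.
Qed.

Lemma spin_term_corner :
  legl iota (delta_mx 0 0) *m spin_term *m legl iota (delta_mx 0 0) = spin_term.
Proof.
have h i : legl iota (delta_mx 0 0) *m e i = e i /\ e i *m legl iota (delta_mx 0 0) = e i.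
  by rewrite /site delta_tens -!(smM iS) !tensmx_mul mulmx1 mul1mx mul_delta_mx.
rewrite /spin_term mulmx_sumr mulmx_suml; apply: eq_bigr => i _.
by rewrite mulmxA (h i).1 -mulmxA ij_comm mulmxA (h i).2.
Qed.

(** Slicing sends [iota w] to the scalar given by one diagonal entry of [w], here 0, and spreads the
    [i]-th spin over the whole space. The factor combines the normalization 1/32 with the ['i] in
    front of the coupling. *)
Lemma site_slice i :
  \sum_c iota (delta_mx c (site i)) *m gen iota spin_term *m iota (delta_mx (site i) c) =
  ((32^-1)%:C%C * 'i%C) *: jota (tau i).
Proof.
have scal w : \sum_c iota (delta_mx c (site i)) *m iota w *m iota (delta_mx (site i) c) =
              w (site i) (site i) *: 1%:M.
  rewrite -(sm1 iS) mx1_sum_delta (sm_sum iS) scaler_sumr; apply: eq_bigr => c _.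
  by rewrite -!(smM iS) -(smZ iS) delta_mul_delta.
have sp : \sum_c iota (delta_mx c (site i)) *m spin_term *m iota (delta_mx (site i) c) =
          jota (tau i).
  transitivity (\sum_c iota (delta_mx c c) *m jota (tau i)).
    apply: eq_bigr => c _; rewrite /spin_term mulmx_sumr mulmx_suml (bigD1 i)//=.
    rewrite big1 => [|j ji]; last first.
      by rewrite mulmxA (sm_unitM iS) site_eq eq_sym (negbTE ji) !mul0mx.
    rewrite addr0 mulmxA (sm_unitM iS) eqxx -mulmxA ij_comm mulmxA (sm_unitM iS).
    by rewrite eqxx.
  by rewrite -mulmx_suml (sm_unit1 iS) mul1mx.
have l0 : levelmx R m (site i) (site i) = 0 by rewrite /levelmx tensmxE !mxE mul0r.
have c0 : couplingmx R m (site i) (site i) = 0.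
  rewrite /couplingmx summxE big1// => a _; rewrite summxE big1// => b _.
  rewrite tensmxE mxE; case: (eqVneq 0 a) => [<-|_]; last by rewrite mul0r.
  by case: (eqVneq 0 b) => [<-|_]; rewrite ?mul0r// /block /block_of /= mxE mulr0.
pose sl X := \sum_c iota (delta_mx c (site i)) *m X *m iota (delta_mx (site i) c).
have slD X Y : sl (X + Y) = sl X + sl Y.
  rewrite /sl -big_split; apply: eq_bigr => c _ /=.
  by rewrite mulmxDr mulmxDl.
have slZ a X : sl (a *: X) = a *: sl X.
  rewrite /sl scaler_sumr; apply: eq_bigr => c _.
  by rewrite -scalemxAr -scalemxAl.
rewrite -/(sl _) /gen slZ /rawgen slD slZ /coupling slD /sl sp !scal l0 c0.
by rewrite !scale0r !add0r scalerA.
Qed.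

End SpinTerm.

(** Otherwise u and v are both below c/4, and the right side of the hypothesis stays below c^2/2 +
    c^2/16. *)
Lemma anticomm_arith (R : realType) (c u v : R) : 0 <= c -> 0 <= u -> 0 <= v ->
  c ^+ 2 <= c * (u + v) + u * v -> c ^+ 2 / 16 <= u ^+ 2 + v ^+ 2.
Proof.
move=> c0 u0 v0 h; rewrite leNgt; apply/negP => lt.
have c1 : u < c / 4 by rewrite -(ltr_pXn2r (n := 2)) ?nnegrE//; nra.
have c2 : v < c / 4 by rewrite -(ltr_pXn2r (n := 2)) ?nnegrE//; nra.
nra.
Qed.

Lemma pairing_arith (R : realType) (t u v x y w w' : R) : 0 <= t -> 0 <= u -> 0 <= v ->
  2 * 32 ^- 2 * t ^+ 2 = x + y + (w - w') ->
  x <= 32^-1 * (2 * v) * t -> y <= 32^-1 * (2 * u) * t -> w <= u * v -> - w' <= u * v ->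
  t ^+ 2 * 32 ^- 2 / 16 <= u ^+ 2 + v ^+ 2.
Proof.
move=> t0 u0 v0 e hx hy hw hw'.
have -> : t ^+ 2 * 32 ^- 2 / 16 = (t / 32) ^+ 2 / 16 by rewrite exprMn exprVn.
apply: anticomm_arith => //; first by rewrite divr_ge0.
have e' : 2 * (t / 32) ^+ 2 = x + y + (w - w') by rewrite -e; field.
by move: e'; move: ((t / 32) ^+ 2) => T; lra.
Qed.

(** * Perturbations of anticommuting unitaries *)

Section Anticommuting.
Variables (R : realType) (d : nat).
Local Notation C := R[i].
Local Notation M := 'M[C]_d.

Lemma nsq1 : nsq (1%:M : M) = d%:R.
Proof.
rewrite nsqE (eq_bigr (fun _ => 1)) => [|i _].
  by rewrite sumr_const card_ord.
rewrite (bigD1 i)//= big1 => [|j ji]; last first.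
  by rewrite mxE eq_sym (negbTE ji) /cmod Normc.normc0 expr0n.
by rewrite mxE eqxx /cmod Normc.normc1 expr1n addr0.
Qed.

Lemma nsq_isom_mull (X Y : M) : adj X *m X = 1%:M -> nsq (X *m Y) = nsq Y.
Proof. by move=> XX; rewrite nsq_ip ip_mull mulmxA XX mul1mx nsq_ip. Qed.

Lemma nsq_isom_mulr (X Y : M) : adj X *m X = 1%:M -> nsq (Y *m X) = nsq Y.
Proof. by move=> /mulmx1C XX; rewrite nsq_ip ip_mulr -mulmxA XX mulmx1 nsq_ip. Qed.

(* Test the vanishing commutator of [p] and [q] against [X *m Y]. *)
Lemma anticommuting_far (z : C) (X Y p q : M) :
    z ^+ 2 = - (32 ^- 2)%:C%C -> cmod z = 32^-1 ->
    adj X = X -> adj Y = Y -> X *m X = 1%:M -> Y *m Y = 1%:M ->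
    X *m Y = - (Y *m X) -> p *m q = q *m p ->
  d%:R * 32 ^- 2 / 16 <= nsq (p - z *: X) + nsq (q - z *: Y).
Proof.
move=> z2 zn aX aY XX YY XY pq.
have [a aE] : exists a : M, a = p - z *: X by eexists.
have [b bE] : exists b : M, b = q - z *: Y by eexists.
rewrite -aE -bE.
have pE : p = z *: X + a by rewrite aE addrC subrK.
have qE : q = z *: Y + b by rewrite bE addrC subrK.
pose W := X *m Y.
have iX : adj X *m X = 1%:M by rewrite aX.
have iY : adj Y *m Y = 1%:M by rewrite aY.
have iW : adj W *m W = 1%:M by rewrite /W adj_mul -!mulmxA (mulmxA (adj X)) iX mul1mx.
(* Expand the vanishing commutator of zX + a and zY + b: the leading term is z^2 (XY - YX) = 2 z^2
   W, and z^2 = -1/32^2. *)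
have key : (2 * 32 ^- 2)%:C%C *: W =
    z *: (X *m b - b *m X) + z *: (a *m Y - Y *m a) + (a *m b - b *m a).
  have z2W : (z * z) *: (X *m Y) - (z * z) *: (Y *m X) = - ((2 * 32 ^- 2)%:C%C *: W).
    have YX : Y *m X = - W by rewrite /W XY opprK.
    rewrite -expr2 z2 YX -/W scalerN opprK -scalerDl -scaleNr; congr (_ *: _).
    by rewrite -opprD -rmorphD /= mulr_natl mulr2n.
  have := pq; rewrite pE qE !mulmxDl !mulmxDr -!scalemxAl -!scalemxAr !scalerA.
  move=> /eqP; rewrite -subr_eq0 => /eqP pq0.
  apply/eqP; rewrite -subr_eq0 -oppr_eq0 opprB -z2W; apply/eqP; rewrite -pq0 !scalerBr.
  move: (z * z *: _) (z * z *: _) (z *: _) (z *: _) (z *: _) (z *: _) (a *m b) (b *m a).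
  move=> t1 t2 t3 t4 t5 t6 t7 t8.
  by apply/matrixP => i j; rewrite !mxE; ring.
have nW (T : M) : ip T W <= nrm T * Num.sqrt d%:R.
  apply: le_trans (ip_le_nrm _ _) _; rewrite (nrmE W) -(mulmx1 W) nsq_isom_mull// nsq1.
  by [].
have nX T : nrm (X *m T) = nrm T by rewrite !nrmE nsq_isom_mull.
have nX' T : nrm (T *m X) = nrm T by rewrite !nrmE nsq_isom_mulr.
have nY T : nrm (Y *m T) = nrm T by rewrite !nrmE nsq_isom_mull.
have nY' T : nrm (T *m Y) = nrm T by rewrite !nrmE nsq_isom_mulr.
have nW1 T : nrm (W *m T) = nrm T by rewrite !nrmE nsq_isom_mull.
have iab : ip (a *m b) W <= nrm a * nrm b.
  by rewrite ip_mulr (le_trans (ip_le_nrm _ _))// nW1 nrm_adj.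
have iba : - ip (b *m a) W <= nrm a * nrm b.
  rewrite -ipNl -mulNmx ip_mulr (le_trans (ip_le_nrm _ _))// nrmN nW1 nrm_adj.
  by rewrite mulrC.
have ix : ip (z *: (X *m b - b *m X)) W <= 32^-1 * (2 * nrm b) * Num.sqrt d%:R.
  apply: le_trans (nW _) _; rewrite nrmZ zn ler_wpM2r ?sqrtr_ge0// ler_wpM2l ?invr_ge0//.
  by rewrite (le_trans (nrmB_le _ _))// nX nX' mulr_natl mulr2n.
have iy : ip (z *: (a *m Y - Y *m a)) W <= 32^-1 * (2 * nrm a) * Num.sqrt d%:R.
  apply: le_trans (nW _) _; rewrite nrmZ zn ler_wpM2r ?sqrtr_ge0// ler_wpM2l ?invr_ge0//.
  by rewrite (le_trans (nrmB_le _ _))// nY nY' mulr_natl mulr2n.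
have := congr1 (fun T => ip T W) key; rewrite /= ipZl -nsq_ip !ipDl ipNl.
rewrite -[nsq W]/(nsq W) -(mulmx1 W) nsq_isom_mull// nsq1 mulmx1 => kE.
have sq : Num.sqrt d%:R ^+ 2 = d%:R :> R by rewrite sqr_sqrtr ?ler0n.
rewrite -!nrm_sqr; move: (sqrtr_ge0 (d%:R : R)) (nrm_ge0 a) (nrm_ge0 b) => h1 h2 h3.
rewrite -sq in kE *; exact: pairing_arith h1 h2 h3 kE ix iy iab iba.
Qed.

End Anticommuting.

(** * Hilbert-Schmidt norms of tensor products *)

Section TensorNorm.
Variable R : realType.
Local Notation C := R[i].

Lemma tensmxBl m n p q (A B : 'M[C]_(m, n)) (D : 'M[C]_(p, q)) :
  (A - B) *t D = A *t D - B *t D.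
Proof. by apply/matrixP => i j; rewrite !mxE mulrBl. Qed.

Lemma tensmxBr m n p q (A B : 'M[C]_(m, n)) (D : 'M[C]_(p, q)) :
  D *t (A - B) = D *t A - D *t B.
Proof. by apply/matrixP => i j; rewrite !mxE mulrBr. Qed.

Lemma nsq_tens n p (A : 'M[C]_n) (B : 'M[C]_p) : nsq (A *t B) = nsq A * nsq B.
Proof.
have sumT (F : 'I_(n * p) -> R) : \sum_l F l = \sum_i \sum_j F (mxtens_index (i, j)).
  rewrite pair_bigA /= (reindex (@mxtens_index n p)) /=.
    by apply: eq_bigr => -[].
  by apply: onW_bij; exists (@mxtens_unindex n p);
    [exact: mxtens_indexK|exact: mxtens_unindexK].
rewrite !nsqE sumT mulr_suml.
apply: eq_bigr => i1 _; rewrite mulr_sumr; apply: eq_bigr => i2 _.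
rewrite sumT mulr_suml; apply: eq_bigr => j1 _; rewrite mulr_sumr.
by apply: eq_bigr => j2 _; rewrite tensmxE /cmod Normc.normcM exprMn.
Qed.

Lemma nsq_delta n (a b : 'I_n) : nsq (delta_mx a b : 'M[C]_n) = 1.
Proof.
rewrite nsqE (bigD1 a)//= (bigD1 b)//= mxE !eqxx /cmod Normc.normc1 expr1n.
rewrite !big1 ?addr0// => [i ia|j jb].
  by rewrite big1// => j _; rewrite mxE (negbTE ia) Normc.normc0 expr0n.
by rewrite mxE (negbTE jb) andbF Normc.normc0 expr0n.
Qed.

Lemma nsq_sum_ortho n (I : finType) (F : I -> 'M[C]_n) :
  (forall i j, i != j -> F i *m adj (F j) = 0) ->
  nsq (\sum_i F i) = \sum_i nsq (F i).
Proof.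
move=> h; rewrite nsq_ip ip_suml; apply: eq_bigr => i _.
rewrite ip_sumr (bigD1 i)//= big1 ?addr0 ?nsq_ip// => j ji.
by rewrite ip.unlock h 1?eq_sym// mxtrace0.
Qed.

End TensorNorm.

(** For the pair below, [S1] and [S3] are the two spin terms; all the other products commute, so the
    smallness of the commutator can be read off from the spins. *)
Lemma com_affine (R : realType) d (X1 X3 S1 S3 : 'M[R[i]]_d) (a b z w : R[i]) :
  X1 *m X3 = X3 *m X1 -> X1 *m S3 = S3 *m X1 -> S1 *m X3 = X3 *m S1 ->
  com (a *: (X1 + z *: S1)) (b *: (X3 + w *: S3)) = (a * b * (z * w)) *: com S1 S3.
Proof.
move=> h1 h2 h3; rewrite /com -!scalemxAl -!scalemxAr.
rewrite !mulmxDl !mulmxDr -!scalemxAl -!scalemxAr h1 h2 h3.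
move: (X3 *m X1) (S3 *m X1) (X3 *m S1) (S1 *m S3) (S3 *m S1) => t1 t2 t3 t4 t5.
by apply/matrixP => i j; rewrite !mxE; ring.
Qed.

(** Here n is the number of sites: it counts the separated pairs on the left, while 4n is the factor
    k of [slice_approx] on the right. Their cancellation makes the final constant independent of
    n. *)
Lemma mean_arith (R : realType) (n x g S : R) : 0 < n ->
  n * (x * 32 ^- 2 / 16) <= (3 + 192 * g) * (4 * n) * S ->
  x <= 4 * (3 + 192 * g) * (16 * 32 ^+ 2) * S.
Proof.
move=> n0; have -> : (3 + 192 * g) * (4 * n) * S = n * ((3 + 192 * g) * 4 * S) by ring.
rewrite ler_pM2l// => h.
have -> : x = x * 32 ^- 2 / 16 * (16 * 32 ^+ 2) by field.
have -> : 4 * (3 + 192 * g) * (16 * 32 ^+ 2) * S =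
          (3 + 192 * g) * 4 * S * (16 * 32 ^+ 2) by ring.
by rewrite ler_pM2r// mulr_gt0// exprn_gt0.
Qed.

(** * The almost commuting pair *)

Section Pair.
Variables (R : realType) (m : nat).
Local Notation N := m.+2.
Local Notation k := (4 * N)%N.
Local Notation r := #|{ffun 'I_N -> bool}|.
Local Notation d := (k * (r * k))%N.
Local Notation C := R[i].

Definition leg1 (w : 'M[C]_k) : 'M[C]_d := w *t (1%:M : 'M[C]_(r * k)).
Definition leg2 (v : 'M[C]_r) : 'M[C]_d := (1%:M : 'M[C]_k) *t (v *t (1%:M : 'M[C]_k)).
Definition leg3 (w : 'M[C]_k) : 'M[C]_d := (1%:M : 'M[C]_k) *t ((1%:M : 'M[C]_r) *t w).

Lemma leg1S : star_morph leg1.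
Proof. exact: star_tensl. Qed.

Lemma leg2S : star_morph leg2.
Proof. exact: star_comp (star_tensr _ _ _) (star_tensl _ _ _). Qed.

Lemma leg3S : star_morph leg3.
Proof. exact: star_comp (star_tensr _ _ _) (star_tensr _ _ _). Qed.

Lemma leg21 w v : leg2 v *m leg1 w = leg1 w *m leg2 v.
Proof. by rewrite !tensmx_mul !mulmx1 !mul1mx. Qed.

Lemma leg23 w v : leg2 v *m leg3 w = leg3 w *m leg2 v.
Proof. by rewrite !tensmx_mul !mulmx1 !mul1mx. Qed.

Lemma leg13 w v : leg1 v *m leg3 w = leg3 w *m leg1 v.
Proof. by rewrite !tensmx_mul !mulmx1 !mul1mx. Qed.

Definition termA : 'M[C]_d := spin_term leg1 leg2 (@spinx R N).
Definition termB : 'M[C]_d := spin_term leg3 leg2 (@spinz R N).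
Definition matA : 'M[C]_d := gen leg1 termA.
Definition matB : 'M[C]_d := gen leg3 termB.

Let termA_adj : adj termA = termA.
Proof. by apply: spin_term_adj leg1S leg2S leg21 _ => i; apply: spinx_adj. Qed.

Let termB_adj : adj termB = termB.
Proof. by apply: spin_term_adj leg3S leg2S leg23 _ => i; apply: spinz_adj. Qed.

Let termA_contr : contr termA.
Proof.
by apply: spin_term_contr leg1S leg2S leg21 _ _ => i; [apply: spinx_adj|apply: spinx_sqr].
Qed.

Let termB_contr : contr termB.
Proof.
by apply: spin_term_contr leg3S leg2S leg23 _ _ => i; [apply: spinz_adj|apply: spinz_sqr].
Qed.

Lemma matA_contr : contr matA.
Proof. exact: gen_contr leg1S termA_contr. Qed.

Lemma matB_contr : contr matB.
Proof. exact: gen_contr leg3S termB_contr. Qed.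

Lemma matA_slice i :
  \sum_c leg1 (delta_mx c (site i)) *m matA *m leg1 (delta_mx (site i) c) =
  ((32^-1)%:C%C * 'i%C) *: leg2 (spinx R i).
Proof. exact: (site_slice _ leg1S leg21). Qed.

Lemma matB_slice i :
  \sum_c leg3 (delta_mx c (site i)) *m matB *m leg3 (delta_mx (site i) c) =
  ((32^-1)%:C%C * 'i%C) *: leg2 (spinz R i).
Proof. exact: (site_slice _ leg3S leg23). Qed.

Lemma sum_site (F : 'I_k -> R) : (forall a, 0 <= F a) ->
  \sum_i F (site i) <= \sum_a F a.
Proof.
move=> F0; rewrite [leRHS](bigID (mem (codom (@site m)))) /=.
rewrite -[leLHS]addr0 lerD ?sumr_ge0//.
rewrite -big_uniq; last by rewrite map_inj_uniq ?enum_uniq// => i j /eqP; rewrite site_eq => /eqP.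
by rewrite big_map big_enum.
Qed.

Lemma pair_separated (A' B' : 'M[C]_d) :
    A' *m B' = B' *m A' -> A' *m adj B' = adj B' *m A' ->
  d%:R <= 4 * (3 + 192 * 10 ^+ 15) * (16 * 32 ^+ 2) *
          (nsq (matA - A') + nsq (matB - B')).
Proof.
move=> AB ABs.
pose K X := X = A' \/ X = adj A'.
have hK : adj_closed K by move=> X [->|->]; [right|left; rewrite adjK].
have hK2 : adj_closed (commutant K) := commutant_adj hK.
have BK : commutant K B'.
  move=> X [->|->] //; apply: (can_inj (@adjK R d)).
  by rewrite !adj_mul adjK.
have A2 : commutant (commutant K) A' by move=> X KX; symmetry; apply: KX; left.
have B3 : commutant (commutant (commutant K)) B'.
  by move=> X hX; symmetry; apply: hX.
have g0 : 0 <= 10 ^+ 15 :> R by rewrite exprn_ge0.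
have [p pS hp] := slice_approx leg1S matA_contr hK g0 A2
  (gen_gap leg1S termA_adj termA_contr (spin_term_corner _ leg1S leg21)).
(* Run with [commutant K] in place of [K], so these slices lie in its double commutant, which is the
   commutant of the algebra containing the [p a]. *)
have [q qS hq] := slice_approx leg3S matB_contr hK2 g0 B3
  (gen_gap leg3S termB_adj termB_contr (spin_term_corner _ leg3S leg23)).
have far i : d%:R * 32 ^- 2 / 16 <=
    nsq (p (site i) - ((32^-1)%:C%C * 'i%C) *: leg2 (spinx R i)) +
    nsq (q (site i) - ((32^-1)%:C%C * 'i%C) *: leg2 (spinz R i)).
  apply: anticommuting_far.
  - rewrite exprMn sqr_i mulrN1 -rmorphXn /= exprVn.
    by [].
  - rewrite /cmod Normc.normcM /= expr0n expr1n add0r sqrtr1 mulr1.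
    by rewrite addr0 sqrtr_sqr ger0_norm// invr_ge0.
  - by rewrite -(smA leg2S) spinx_adj.
  - by rewrite -(smA leg2S) spinz_adj.
  - by rewrite -(smM leg2S) spinx_sqr (sm1 leg2S).
  - by rewrite -(smM leg2S) spinz_sqr (sm1 leg2S).
  - by rewrite -!(smM leg2S) spin_mul eqxx expr1 scaleN1r (smN leg2S).
  - by rewrite qS//; apply: pS.
apply: (@mean_arith _ N%:R); first by rewrite ltr0n.
have -> : 4 * N%:R = k%:R :> R by rewrite natrM.
rewrite mulrDr; apply: le_trans (lerD hp hq).
apply: le_trans (lerD (sum_site _) (sum_site _)) => [|a|a]; try exact: nsq_ge0.
rewrite (_ : N%:R * _ = \sum_(i < N) (d%:R * 32 ^- 2 / 16)); last first.
  by rewrite sumr_const card_ord mulr_natl.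
rewrite -big_split /=.
apply: ler_sum => i _; rewrite matA_slice matB_slice; exact: far.
Qed.

Lemma com_terms : com termA termB =
  \sum_i delta_mx (site i) (site i) *t
    (((2 : R)%:C%C *: (spinx R i *m spinz R i)) *t delta_mx (site i) (site i)).
Proof.
have tA : termA = \sum_i delta_mx (site i) (site i) *t (spinx R i *t (1%:M : 'M[C]_k)).
  by apply: eq_bigr => i _; rewrite !tensmx_mul !mulmx1 !mul1mx.
have tB : termB = \sum_i (1%:M : 'M[C]_k) *t (spinz R i *t delta_mx (site i) (site i)).
  by apply: eq_bigr => i _; rewrite !tensmx_mul !mulmx1 !mul1mx.
have tAB : com termA termB = \sum_i \sum_j delta_mx (site i) (site i) *t
   ((spinx R i *m spinz R j - spinz R j *m spinx R i) *t delta_mx (site j) (site j)).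
  rewrite /com tA tB mulmx_suml mulmx_sumr -sumrB; apply: eq_bigr => i _.
  rewrite mulmx_sumr mulmx_suml -sumrB; apply: eq_bigr => j _.
  by rewrite !tensmx_mul !mulmx1 !mul1mx tensmxBl tensmxBr.
rewrite tAB; apply: eq_bigr => i _; rewrite (bigD1 i)//= big1 ?addr0 => [|j ji].
  congr (_ *t (_ *t _)).
  have -> : spinz R i *m spinx R i = - (spinx R i *m spinz R i).
    by rewrite spin_mul eqxx expr1 scaleN1r opprK.
  by rewrite opprK -{1 2}[_ *m _]scale1r -scalerDl rmorph_nat mulr2n.
by rewrite spin_mul eq_sym (negbTE ji) expr0 scale1r subrr tens0mx tensmx0.
Qed.

(** Since d = 16 N^2 r, this is a fraction 1/(4N) of the dimension. *)
Lemma nsq_com_terms : nsq (com termA termB) = 4 * (N%:R * r%:R).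
Proof.
rewrite com_terms nsq_sum_ortho => [|i j ij]; last first.
  rewrite adj_tens tensmx_mul adj_delta mul_delta_mx_cond.
  by rewrite site_eq (negbTE ij) mulr0n tens0mx.
rewrite (eq_bigr (fun=> 4 * r%:R)) => [|i _].
  by rewrite sumr_const card_ord -[LHS]mulr_natl mulrCA.
rewrite !nsq_tens !nsq_delta mul1r mulr1 nsqZ cmod_sqr /= expr0n addr0.
rewrite nsq_isom_mull ?spinx_adj ?spinx_sqr//.
rewrite -[spinz R i]mulmx1 nsq_isom_mull ?spinz_adj ?spinz_sqr// nsq1.
by congr (_ * _); rewrite -natrX.
Qed.

Lemma gen_affine (iota : 'M[C]_k -> 'M[C]_d) (t : 'M[C]_d) : star_morph iota ->
  gen iota t = (32^-1)%:C%C *: (iota (levelmx R m + 'i%C *: couplingmx R m) + 'i%C *: t).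
Proof.
move=> iS; rewrite /gen /rawgen /coupling (smD iS) (smZ iS); congr (_ *: _).
by rewrite scalerDr addrA.
Qed.

Lemma adj_gen_affine (iota : 'M[C]_k -> 'M[C]_d) (t : 'M[C]_d) :
    star_morph iota -> adj t = t ->
  adj (gen iota t) =
  (32^-1)%:C%C *: (iota (levelmx R m - 'i%C *: couplingmx R m) + (- 'i%C) *: t).
Proof.
move=> iS ta; rewrite /gen adjZ conjc_real rawgen_adj//; congr (_ *: _).
by rewrite /coupling (smD iS) (smN iS) (smZ iS) scalerDr opprD addrA scaleNr.
Qed.

Let leg1_termB w : leg1 w *m termB = termB *m leg1 w.
Proof.
rewrite mulmx_sumr mulmx_suml; apply: eq_bigr => i _.
by rewrite mulmxA leg13 -!mulmxA leg21.
Qed.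

Let termA_leg3 w : termA *m leg3 w = leg3 w *m termA.
Proof.
rewrite mulmx_sumr mulmx_suml; apply: eq_bigr => i _.
by rewrite -mulmxA leg23 !mulmxA leg13.
Qed.

Lemma com_small (w : C) : cmod w ^+ 2 <= 1 ->
  nsq (w *: com termA termB) <= d%:R / N%:R.
Proof.
move=> w1; rewrite nsqZ nsq_com_terms.
have n0 : 0 < N%:R :> R by rewrite ltr0n.
have -> : d%:R / N%:R = 16 * (N%:R * r%:R) :> R.
  by rewrite !natrM; field; rewrite gt_eqF.
have : 0 <= N%:R * r%:R :> R by rewrite mulr_ge0 ?ler0n.
by have := sqr_ge0 (cmod w); move: (N%:R * r%:R) (cmod w ^+ 2) w1 => x y; nra.
Qed.

Let scale_small (w : C) : cmod w ^+ 2 = 1 ->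
  cmod ((32^-1)%:C%C * (32^-1)%:C%C * ('i%C * w)) ^+ 2 <= 1 :> R.
Proof.
move=> w1; rewrite /cmod !Normc.normcM !exprMn -!/(cmod _) w1 !cmod_sqr /=.
by rewrite !expr0n !addr0 add0r expr1n !mulr1; lra.
Qed.

Lemma com_matAB : nsq (matA *m matB - matB *m matA) <= d%:R / N%:R.
Proof.
rewrite -/(com _ _) /matA /matB (gen_affine _ leg1S) (gen_affine _ leg3S).
rewrite (com_affine _ _ _ _ (leg13 _ _) (leg1_termB _) (termA_leg3 _)).
by apply: com_small; apply: scale_small; rewrite cmod_sqr /= expr0n expr1n add0r.
Qed.

Lemma com_matABs : nsq (matA *m adj matB - adj matB *m matA) <= d%:R / N%:R.
Proof.
rewrite -/(com _ _) /matA /matB (gen_affine _ leg1S) (adj_gen_affine leg3S termB_adj).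
rewrite (com_affine _ _ _ _ (leg13 _ _) (leg1_termB _) (termA_leg3 _)).
apply: com_small; apply: scale_small.
by rewrite cmod_sqr /= oppr0 expr0n sqrrN expr1n add0r.
Qed.

End Pair.

(** * Passage to the normalized norms and the limit *)

Local Open Scope classical_set_scope.

Lemma hsnormE (R : realType) d (A : 'M[R[i]]_d) :
  hsnorm A = Num.sqrt (d%:R^-1 * nsq A).
Proof. by rewrite /hsnorm nsqE. Qed.

Lemma contr_opnorm (R : realType) d (A : 'M[R[i]]_d) : contr A -> opnorm A <= 1.
Proof.
move=> cA; apply: ge_sup.
  exists (vnorm (A *m 0)); exists 0 => //=.
  rewrite /vnorm big1 ?sqrtr0// => i _; rewrite mxE /cmod Normc.normc0.
  by rewrite expr0n.
move=> _ /= [v v1 <-]; apply: le_trans v1; rewrite /vnorm.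
case: d A cA v => [|d] A cA v; first by rewrite !big_ord0.
(* A vector is tested as the matrix having it as first column and zeros elsewhere. *)
have col (w : 'cV[R[i]]_d.+1) :
    nsq (w *m (delta_mx 0 0 : 'rV_d.+1)) = \sum_i cmod (w i ord0) ^+ 2.
  rewrite nsqE; apply: eq_bigr => i _; rewrite (bigD1 ord0)//= big1 => [|j j0].
    by rewrite addr0 mxE big_ord1 mxE !eqxx mulr1.
  by rewrite mxE big_ord1 mxE (negbTE j0) andbF mulr0 /cmod Normc.normc0 expr0n.
by rewrite -!col ler_wsqrtr// -mulmxA.
Qed.

Lemma hsnorm_lim (R : realType) (d : nat -> nat) (X : forall n, 'M[R[i]]_(d n)) :
    (forall n, (0 < d n)%N) ->
    (forall n, nsq (X n) <= (d n)%:R / n.+2%:R) ->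
  (fun n => hsnorm (X n)) @ \oo --> (0 : R).
Proof.
move=> d0 hX.
have lim0 : (fun n => Num.sqrt (n.+1%:R^-1)) @ \oo --> (0 : R).
  rewrite -[X in _ --> X]sqrtr0; apply: continuous_cvg; first exact: sqrt_continuous.
  exact: cvg_harmonic.
apply: (squeeze_cvgr _ (cvg_cst 0) lim0).
near=> n; rewrite hsnormE sqrtr_ge0 /= ler_wsqrtr//.
have dn : 0 < (d n)%:R :> R by rewrite ltr0n.
rewrite ler_pdivrMl//; apply: le_trans (hX n) _; rewrite ler_pM2l//.
by rewrite lef_pV2 ?posrE ?ltr0n// ler_nat.
Unshelve. all: by end_near.
Qed.

Theorem theoremA (R : realType) :
  exists (d : nat -> nat) (A B : forall n : nat, 'M[R[i]]_(d n)),
    (forall n, (0 < d n)%N) /\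
    (forall n, opnorm (A n) <= 1 /\ opnorm (B n) <= 1) /\
    ((fun n => hsnorm (A n *m B n - B n *m A n)) @ \oo --> (0 : R)) /\
    ((fun n => hsnorm (A n *m adj (B n) - adj (B n) *m A n)) @ \oo --> (0 : R)) /\
    (forall A' B' : forall n : nat, 'M[R[i]]_(d n),
       (forall n, A' n *m B' n = B' n *m A' n /\
                  A' n *m adj (B' n) = adj (B' n) *m A' n) ->
       0 < inf [set hsnorm (A n - A' n) + hsnorm (B n - B' n) | n in [set: nat]]).
Proof.
pose d n := (4 * n.+2 * (#|{ffun 'I_n.+2 -> bool}| * (4 * n.+2)))%N.
have d0 n : (0 < d n)%N.
  by rewrite !muln_gt0 /= card_ffun card_bool expn_gt0.
exists d, (fun n => matA R n), (fun n => matB R n); split => //; split.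
  by move=> n; split; apply: contr_opnorm; [apply: matA_contr|apply: matB_contr].
split; first by apply: hsnorm_lim => // n; apply: com_matAB.
split; first by apply: hsnorm_lim => // n; apply: com_matABs.
move=> A' B' AB'.
pose K : R := 4 * (3 + 192 * 10 ^+ 15) * (16 * 32 ^+ 2).
have K0 : 0 < K.
  by rewrite /K !mulr_gt0 ?exprn_gt0 ?addr_gt0 ?mulr_gt0 ?exprn_gt0.
(* For the two distances a and b, [pair_separated] divided by the dimension reads 1 <= K (a^2 +
   b^2), and a^2 + b^2 <= (a + b)^2; hence the witness. *)
apply: (@lt_le_trans _ _ (Num.sqrt K^-1)); first by rewrite sqrtr_gt0 invr_gt0.
apply: lb_le_inf; first by exists (hsnorm (matA R 0 - A' 0%N) + hsnorm (matB R 0 - B' 0%N)), 0%N.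
move=> _ /= [n _ <-]; have [h1 h2] := AB' n.
have dn : 0 < (d n)%:R :> R by rewrite ltr0n.
have := pair_separated h1 h2; rewrite -/K -/(d n).
have a0 : 0 <= hsnorm (matA R n - A' n) by rewrite sqrtr_ge0.
have b0 : 0 <= hsnorm (matB R n - B' n) by rewrite sqrtr_ge0.
have nsqh (X : 'M[R[i]]_(d n)) : nsq X = (d n)%:R * hsnorm X ^+ 2.
  by rewrite hsnormE sqr_sqrtr ?mulr_ge0 ?invr_ge0 ?nsq_ge0 ?ler0n// mulrA mulfV ?mul1r ?gt_eqF.
rewrite !nsqh -mulrDr mulrCA -{1}[(d n)%:R]mulr1 ler_pM2l// => h.
rewrite -(ler_pXn2r (n := 2)) ?nnegrE ?sqrtr_ge0 ?addr_ge0//.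
rewrite sqr_sqrtr ?invr_ge0 ?(ltW K0)// -[K^-1]mulr1 ler_pdivrMl//.
apply: le_trans h _; rewrite ler_pM2l// sqrrD.
by rewrite addrAC lerDl mulrn_wge0// mulr_ge0.
Qed.
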